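(* Let $1\le p<\infty$, let $\nu:\mathbb{R}^d\setminus\{0\}\to[0,\infty)$ be measurable and symmetric ($\nu(h)=\nu(-h)$) with $\nu\in L^1(\mathbb{R}^d\setminus B(0,r))$ for every $r>0$, and assume $\nu\not\equiv0$, i.e. $|\{\nu>0\}|>0$. Let $\Omega\subset\mathbb{R}^d$ be open with $|\Omega|<\infty$. Set $q_0=q:=1\wedge\nu$, $q_m=q_{m-1}*q_{m-1}$, and $$C^\#_m=2^{pm}\|q\|^{2^m-1}_{L^1(\mathbb{R}^d)}\big(q_m^\#(|\Omega|)\big)^{-1}.$$ Then for every $m\in\mathbb{N}$ $$\|u\|^p_{L^p(\Omega)}\le C^\#_m\,\mathcal{E}(u,u)\qquad\text{for all }u\in L^p_\Omega(\mathbb{R}^d),$$ and for all sufficiently large $m$ one has $0<C^\#_m=C(d,p,|\Omega|,m,\nu)<\infty$.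
   Context: $L^p_\Omega(\mathbb{R}^d)=\{u\in L^p(\mathbb{R}^d):u=0\text{ a.e. on }\Omega^c\}$, $\Omega^c=\mathbb{R}^d\setminus\Omega$, and $$\mathcal{E}(u,u)=\iint_{(\Omega^c\times\Omega^c)^c}|u(x)-u(y)|^p\nu(x-y)\,dy\,dx\in[0,\infty],$$ which for $u\in L^p_\Omega(\mathbb{R}^d)$ equals the integral over $\mathbb{R}^d\times\mathbb{R}^d$. $1\wedge\nu=\min(1,\nu)$; $*$ is convolution. For a measurable $\rho\ge0$ on $\mathbb{R}^d$, the symmetric rearrangement is $\rho^*(x)=\inf\{s>0:|\{\rho>s\}|\le|B_1(0)|\,|x|^d\}$ (a radial function, written $\rho^*(r)$ for $|x|=r$). For $0<t<\infty$, with $r_t=(t/|B_1(0)|)^{1/d}$, $$\rho^\#(t)=\int_{\{\rho<\rho^*(r_t)\}}\rho(h)\,dh .$$ If $q_m^\#(|\Omega|)=0$, $C_m^\#$ is understood as $+\infty$ (with $\infty\cdot0=0$). *)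

(* Defs.v *)
From HB Require Import structures.
From mathcomp Require Import all_boot all_order all_algebra.
From mathcomp Require Import all_classical all_reals all_analysis.

Set Implicit Arguments.
Unset Strict Implicit.
Unset Printing Implicit Defensive.

Import Order.TTheory GRing.Theory Num.Theory.
Import numFieldNormedType.Exports.

Local Open Scope classical_set_scope.
Local Open Scope ring_scope.

Definition measure_rV_display : measure_display -> measure_display.
Proof. exact. Qed.

(* The product sigma-algebra on row vectors, as the library does for tuples;
   on 'rV[R]_n it is the Borel sigma-algebra. *)
Section measurable_rV.
Context {d : measure_display} {T : sigmaRingType d} (n : nat).

Let coors : 'I_n -> 'rV[T]_n -> T := fun i x => x ord0 i.

Let rV_set0 : g_sigma_preimage coors set0.
Proof. exact: sigma_algebra0. Qed.

Let rV_setC A : g_sigma_preimage coors A -> g_sigma_preimage coors (~` A).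
Proof. exact: sigma_algebraC. Qed.

Let rV_bigcup (F : _^nat) : (forall i, g_sigma_preimage coors (F i)) ->
  g_sigma_preimage coors (\bigcup_i (F i)).
Proof. exact: sigma_algebra_bigcup. Qed.

HB.instance Definition _ := @isMeasurable.Build (measure_rV_display d)
  'rV[T]_n (g_sigma_preimage coors) rV_set0 rV_setC rV_bigcup.

End measurable_rV.

Section measurable_rV_fun.
Context (R : realType).

Lemma measurable_coord n (i : 'I_n) :
  measurable_fun [set: 'rV[R]_n] (fun x : 'rV[R]_n => x ord0 i).
Proof.
move=> _ Y mY; rewrite setTI; apply: sub_sigma_algebra => /=.
rewrite -bigcup_seq/=; exists i => /=; first by rewrite mem_index_enum.
by exists Y => //; rewrite setTI.
Qed.

Lemma measurable_fun_coordP d (T : measurableType d) n (f : T -> 'rV[R]_n) :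
  (forall i, measurable_fun [set: T] (fun x => f x ord0 i)) ->
  measurable_fun [set: T] f.
Proof.
move=> mf _ A mA; rewrite setTI.
suff sub : @measurable _ 'rV[R]_n `<=` [set A | measurable (f @^-1` A)].
  exact: sub.
apply: smallest_sub.
  split => /=; first by rewrite preimage_set0.
  - by move=> B mB; rewrite setTD preimage_setC; exact: measurableC.
  - by move=> F mF; rewrite preimage_bigcup; exact: bigcupT_measurable.
rewrite -bigcup_seq => B /= [i _ /= [C mC <-]].
by rewrite setTI; have := mf i measurableT _ mC; rewrite setTI.
Qed.

Definition cons_rV n (z : measurableTypeR R * 'rV[R]_n) : 'rV[R]_n.+1 :=
  row_mx (z.1)%:M z.2.

Lemma measurable_cons_rV n :
  measurable_fun [set: measurableTypeR R * 'rV[R]_n] (@cons_rV n).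
Proof.
apply: measurable_fun_coordP => i.
case: (split_ordP (i : 'I_(1 + n))) => j ->.
  rewrite [X in measurable_fun _ X](_ : _ = fst); last first.
    by apply/funext => z; rewrite [LHS](row_mxEl (z.1)%:M) (ord1 j) mxE eqxx mulr1n.
  exact: measurable_fst.
rewrite [X in measurable_fun _ X](_ : _ =
    (fun x : 'rV[R]_n => x ord0 j) \o snd); last first.
  by apply/funext => z; exact: row_mxEr.
apply: measurableT_comp; last exact: measurable_snd.
exact: measurable_coord.
Qed.

End measurable_rV_fun.

Section lebesgue_measure_rV.
Context (R : realType).
Local Open Scope ereal_scope.
Local Open Scope measure_scope.

Section step.
Context (n : nat) (mu : {sigma_finite_measure set 'rV[R]_n -> \bar R}).

Definition cons_measure : set 'rV[R]_n.+1 -> \bar R :=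
  pushforward ((@lebesgue_measure R) \x mu) (@cons_rV R n).

Let cons_measure0 : cons_measure set0 = 0.
Proof. by rewrite /cons_measure /pushforward preimage_set0 measure0. Qed.

Let cons_measure_ge0 A : 0 <= cons_measure A.
Proof. by rewrite /cons_measure /pushforward measure_ge0. Qed.

Let cons_measure_sigma_additive : semi_sigma_additive cons_measure.
Proof.
have mcons A : measurable A -> measurable (@cons_rV R n @^-1` A).
  by move=> mA; rewrite -[X in measurable X]setTI; exact: measurable_cons_rV.
move=> F mF tF mUF; rewrite /cons_measure /pushforward preimage_bigcup.
apply: measure_semi_sigma_additive.
- by move=> i; exact: mcons.
- apply/trivIsetP => /= i j _ _ ij; rewrite -preimage_setI.
  by move/trivIsetP : tF => /(_ _ _ _ _ ij) ->//; rewrite preimage_set0.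
- by rewrite -preimage_bigcup; exact: mcons.
Qed.

HB.instance Definition _ := isMeasure.Build _ _ _ cons_measure
  cons_measure0 cons_measure_ge0 cons_measure_sigma_additive.

Let cons_measure_sigma_finite : sigma_finite setT cons_measure.
Proof.
have /sigma_finiteP[F [FT ndF Foo]] := sigma_finiteT (@lebesgue_measure R).
have /sigma_finiteP[G [GT ndG Goo]] := sigma_finiteT mu.
pose tail (x : 'rV[R]_n.+1) : measurableTypeR R * 'rV[R]_n :=
  (x ord0 ord0, \row_(j < n) x ord0 (lift ord0 j)).
have consK z : tail (cons_rV z) = z.
  case: z => a v; rewrite /tail; congr pair.
    have -> : ord0 = lshift n (ord0 : 'I_1) by exact/val_inj.
    by rewrite [LHS](row_mxEl a%:M) mxE eqxx mulr1n.
  apply/rowP => j; rewrite mxE.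
  have -> : lift ord0 j = rshift 1 j by exact/val_inj.
  exact: row_mxEr.
have mtail : measurable_fun setT tail.
  apply/measurable_fun_pairP; split.
    exact: measurable_coord.
  apply: measurable_fun_coordP => i.
  rewrite [X in measurable_fun _ X](_ : _ =
      fun x : 'rV[R]_n.+1 => x ord0 (lift ord0 i)).
    exact: measurable_coord.
  by apply/funext => x; rewrite /= mxE.
exists (fun i => tail @^-1` (F i `*` G i)) => [|i].
  apply/seteqP; split => // x _.
  have [k _ Fkx] : (\bigcup_i F i) (tail x).1 by rewrite -FT.
  have [l _ Glx] : (\bigcup_i G i) (tail x).2 by rewrite -GT.
  exists (maxn k l) => //; split.
    by move: (tail x).1 Fkx; exact/subsetPset/ndF/leq_maxl.
  by move: (tail x).2 Glx; exact/subsetPset/ndG/leq_maxr.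
have [mF Fi] := Foo i; have [mG Gi] := Goo i; split.
  by rewrite -[X in measurable X]setTI; apply: mtail => //; exact: measurableX.
rewrite /cons_measure /pushforward -comp_preimage.
rewrite (_ : tail \o @cons_rV R n = id); last by apply/funext => z; exact: consK.
by rewrite preimage_id product_measure1E// lte_mul_pinfty// ge0_fin_numE.
Qed.

HB.instance Definition _ := Measure_isSigmaFinite.Build _ _ _ cons_measure
  cons_measure_sigma_finite.

End step.

(* The d-fold product of the Lebesgue measure of the line; the product over no
   factor is the Dirac mass at the only point of R^0. *)
Fixpoint product_lebesgue (d : nat) :
    {sigma_finite_measure set 'rV[R]_d -> \bar R} :=
  if d is n.+1 then cons_measure (product_lebesgue n) else \d_(0%R : 'rV[R]_0).

(* The outer measure agrees with product_lebesgue on Borel sets, and is also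
   the Lebesgue measure of the Lebesgue measurable sets that are not Borel, as
   for the library's lebesgue_measure on the line. *)
Definition lebesgue_rV (d : nat) : set 'rV[R]_d -> \bar R :=
  (product_lebesgue d)^*.

Section lebesgue_rV_measure.
Context (d : nat).

Lemma lebesgue_rVE (A : set 'rV[R]_d) :
  measurable A -> lebesgue_rV A = product_lebesgue d A.
Proof. exact: measurable_mu_extE. Qed.

Let lebesgue_rV0 : @lebesgue_rV d set0 = 0.
Proof. by rewrite lebesgue_rVE. Qed.

Let lebesgue_rV_ge0 A : 0 <= @lebesgue_rV d A.
Proof. exact: mu_ext_ge0. Qed.

Let lebesgue_rV_sigma_additive : semi_sigma_additive (@lebesgue_rV d).
Proof.
move=> F mF tF mUF; rewrite lebesgue_rVE//.
under eq_fun do under eq_bigr do rewrite lebesgue_rVE//.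
exact: measure_semi_sigma_additive.
Qed.

HB.instance Definition _ := isMeasure.Build _ _ _ (@lebesgue_rV d)
  lebesgue_rV0 lebesgue_rV_ge0 lebesgue_rV_sigma_additive.

Let lebesgue_rV_sigma_finite : sigma_finite setT (@lebesgue_rV d).
Proof.
have [F FT Foo] := sigma_finiteT (product_lebesgue d).
by exists F => // i; have [mF ?] := Foo i; rewrite lebesgue_rVE.
Qed.

HB.instance Definition _ := Measure_isSigmaFinite.Build _ _ _ (@lebesgue_rV d)
  lebesgue_rV_sigma_finite.

End lebesgue_rV_measure.

End lebesgue_measure_rV.

Section nonlocal_energy.
Context (R : realType) (d : nat).
Local Notation V := 'rV[R]_d.
Local Notation vol := (@lebesgue_rV R d).
Implicit Types (p t : R) (nu u : V -> R) (rho : V -> \bar R).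
Local Open Scope ereal_scope.

(* The library norm on 'rV[R]_d is the maximum norm. *)
Definition enorm (x : V) : R := Num.sqrt (\sum_(i < d) x ord0 i ^+ 2)%R.

Definition eball (r : R) : set V := [set x | (enorm x < r)%R].

(* Measurability for the completed measure: measurable_fun refers to Borel sets.
   The library integral of a nonnegative function is a supremum over Borel
   simple functions below it, hence depends only on the a.e. class of such a
   function and is its Lebesgue integral. *)
Definition lebesgue_measurable (f : V -> R) : Prop :=
  exists2 g : V -> R, measurable_fun setT g & {ae vol, forall x, f x = g x}.

Definition in_Lp p u : Prop :=
  lebesgue_measurable u /\ 'N[vol]_(p%:E)[EFin \o u] < +oo.

Definition in_Lp_supported p (Omega : set V) u : Prop :=
  in_Lp p u /\ {ae vol, forall x, ~ Omega x -> u x = 0%R}.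

Definition energy p nu (Omega : set V) u : \bar R :=
  \int[vol \x vol]_(z in ~` ((~` Omega) `*` (~` Omega)))
    (`|u z.1 - u z.2| `^ p * nu (z.1 - z.2))%:E.

Definition convolution (f g : V -> \bar R) (x : V) : \bar R :=
  \int[vol]_y (f (x - y)%R * g y).

Definition qker nu (m : nat) : V -> \bar R :=
  iter m (fun f => convolution f f) (fun h => (Num.min 1 (nu h))%:E).

(* rho^* as a function of the radius r = |x| *)
Definition rearrangement rho (r : R) : \bar R :=
  ereal_inf [set s%:E | s in [set s : R | (0 < s)%R /\
    vol [set x | s%:E < rho x] <= vol (eball 1) * (r ^+ d)%:E]].

Definition volume_radius t : R := ((t / fine (vol (eball 1))) `^ d%:R^-1)%R.

(* At t = 0, which occurs only for an empty Omega, the same formula is used. *)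
Definition sharp rho t : \bar R :=
  \int[vol]_(h in [set h | rho h < rearrangement rho (volume_radius t)]) rho h.

Definition Csharp p nu t (m : nat) : \bar R :=
  let s := sharp (qker nu m) t in
  if s == 0 then +oo
  else (2 `^ (p * m%:R))%:E * 'N[vol]_1[qker nu 0] ^+ (2 ^ m - 1)%N / s.

End nonlocal_energy.

(* Main.v *)
From HB Require Import structures.
Require Import Defs.
From mathcomp Require Import all_boot all_order all_algebra.
From mathcomp Require Import all_classical all_reals all_analysis.
From mathcomp Require Import measurable_realfun simple_functions ring lra.

Set Implicit Arguments.
Unset Strict Implicit.
Unset Printing Implicit Defensive.

Import Order.TTheory GRing.Theory Num.Theory.
Import numFieldNormedType.Exports.

Local Open Scope classical_set_scope.
Local Open Scope ring_scope.
Local Open Scope ereal_scope.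

(** For an even, bounded, integrable weight f >= 0 let E_f(u) be the double
    integral of |u(x) - u(y)|^p f(x - y), that is, the integral of f Phi where Phi(h) is the
    integral over x of |u(x) - u(x - h)|^p.

    The inequality compares two bounds for E_{q_m}(u). From above, convexity and
    translation invariance give Phi(b + k) <= 2^(p-1) (Phi(b) + Phi(k)), hence
    E_{f*f} <= 2^p |f|_1 E_f (kernel_energy_convolution); iterating from q <= nu
    yields E_{q_m} <= 2^(pm) |q|_1^(2^m - 1) E_nu (kernel_energy_qker). From
    below, if u vanishes off Omega, each x contributes to E_f at least |u(x)|^p
    times the integral of f over the complement of x - Omega, and the bathtub
    principle bounds that integral by f^#(|Omega|) (sharp_le_kernel_energy).

    It remains to see that q_m^#(|Omega|) > 0 for large m, i.e. that q_m takes
    positive values below q_m^*(r) on a set of positive measure. Both arguments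
    cut with half-spaces x_1 > r, and use that hyperplanes are null, so that the
    mass of f beyond such a cut takes arbitrarily small positive values
    (small_halfspace_integral). First, if T is this mass, then f * f is at most
    2 T sup f on x_1 > 2r without vanishing there, so f * f takes arbitrarily
    small positive values (integral_sublevel_convolution_gt0). Second, the
    support of f * f contains, up to null sets, the translates of the support
    of f by a and by -a for almost every a in it; when a is far out in the first
    coordinate, these translates overlap little, and the volume of the support
    grows at least by the factor 3/2 (support_convolution_growth). Hence the
    support of q_m eventually has volume more than |Omega|, which makes q_m^*(r)
    positive (sharp_convolution_gt0).

    All quantities in the statement depend only on the almost everywhere classes
    of nu and u, so nu may be taken Borel, nonnegative and even, and u Borel and
    zero off Omega. *)

Lemma exists_natSinv_lt (R : realType) (x : R) : (0 < x)%R ->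
  exists n : nat, (n.+1%:R^-1 < x)%R.
Proof.
move=> x0; have [n _ hn] := near_infty_natSinv_lt (PosNum x0).
by exists n; exact: hn n (leqnn n).
Qed.

(** * Integrals of functions that are measurable only up to a null set *)

Section ae_integral.
Context d (T : measurableType d) (R : realType) (mu : {measure set T -> \bar R}).
Implicit Types f g : T -> \bar R.
Import HBNNSimple.

(** The integral of a nonnegative function is a supremum over the simple
    functions below it, so monotonicity needs no measurability. *)
Lemma ge0_le_integral_nonmeasurable f g :
  (forall x, 0 <= f x) -> (forall x, f x <= g x) ->
  \int[mu]_x f x <= \int[mu]_x g x.
Proof.
move=> f0 fg; rewrite !ge0_integralTE//; last first.
  by move=> x; exact: le_trans (fg x).
apply: ge_ereal_sup => _ [h/= hf <-]; apply: ereal_sup_ubound.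
by exists h => // x; exact: le_trans (fg x).
Qed.

Let ge0_ae_eq_nonmeasurable f g : measurable_fun setT g ->
  (forall x, 0 <= f x) -> (forall x, 0 <= g x) ->
  {ae mu, forall x, f x = g x} -> \int[mu]_x f x = \int[mu]_x g x.
Proof.
move=> mg f0 g0 [N [mN N0 fgN]].
have fg x : ~ N x -> f x = g x by move=> Nx; apply: contrapT => fgx; exact/Nx/fgN.
apply/eqP; rewrite eq_le; apply/andP; split.
  (* A Borel majorant of f: raise g to +oo on the exceptional null set. *)
  pose h x := if x \in N then +oo else g x.
  apply: (@le_trans _ _ (\int[mu]_x h x)).
    apply: ge0_le_integral_nonmeasurable => // x; rewrite /h.
    by case: ifPn => [_|/negP Nx]; rewrite ?leey// fg// => ?; exact/Nx/mem_set.
  rewrite le_eqVlt; apply/orP; left; apply/eqP.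
  apply: ge0_ae_eq_integral => //.
  - apply: measurable_fun_ifT => //; apply: (measurable_fun_bool true).
    rewrite setTI (_ : _ @^-1` _ = N)//.
    by apply/seteqP; split => x /=; [exact: set_mem|exact: mem_set].
  - by move=> x _; rewrite /h; case: ifP.
  - exists N; split => // x /=; rewrite /h; case: ifPn => [/set_mem//|_].
    by move=> /not_implyP[].
(* A Borel minorant of f: kill g on the exceptional null set. *)
pose h := g \_ (~` N).
apply: (@le_trans _ _ (\int[mu]_x h x)).
  rewrite le_eqVlt; apply/orP; left; apply/eqP.
  apply: ge0_ae_eq_integral => //.
  - by apply/(measurable_restrictT _ _).1; [exact: measurableC|exact: measurable_funTS].
  - by move=> x _; rewrite /h patchE; case: ifP.
  - exists N; split => // x /= /not_implyP[_]; rewrite /h patchE.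
    by case: ifPn => //; rewrite notin_setE/= => /contrapT.
apply: ge0_le_integral_nonmeasurable => x; rewrite /h patchE; case: ifPn => //.
by move=> /set_mem Nx; rewrite fg.
Qed.

(** Squeezing f between two Borel modifications of g on a null set shows that
    only the almost everywhere class of the integrand matters. *)
Lemma ae_eq_integral_nonmeasurable f g : measurable_fun setT g ->
  {ae mu, forall x, f x = g x} -> \int[mu]_x f x = \int[mu]_x g x.
Proof.
move=> mg fg; rewrite integralE [RHS]integralE; congr (_ - _).
  apply: ge0_ae_eq_nonmeasurable => //; first exact: measurable_funepos.
  by apply: filterS fg => x; rewrite !funeposE => ->.
apply: ge0_ae_eq_nonmeasurable => //; first exact: measurable_funeneg.
by apply: filterS fg => x; rewrite !funenegE => ->.
Qed.
End ae_integral.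

(** * Lebesgue measure on row vectors *)

Lemma ge0_integral_measure_preserving d (T : measurableType d) (R : realType)
    (mu : {measure set T -> \bar R}) (phi : T -> T) (f : T -> \bar R) :
  measurable_fun setT phi ->
  (forall A, measurable A -> mu (phi @^-1` A) = mu A) ->
  measurable_fun setT f -> (forall x, 0 <= f x) ->
  \int[mu]_x f (phi x) = \int[mu]_x f x.
Proof.
move=> mphi muphi mf f0.
rewrite -(@ge0_integral_pushforward _ _ _ _ R phi mphi mu setT f)//.
by apply: eq_measure_integral => A mA _; exact: muphi.
Qed.

Section lebesgue_rV_theory.
Context (R : realType).

Lemma cons_rV_head n (z : measurableTypeR R * 'rV[R]_n) (j : 'I_1) :
  cons_rV z ord0 (lshift n j) = z.1.
Proof. by rewrite [LHS](row_mxEl (z.1)%:M) (ord1 j) mxE eqxx mulr1n. Qed.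

Lemma cons_rV_tail n (z : measurableTypeR R * 'rV[R]_n) (j : 'I_n) :
  cons_rV z ord0 (rshift 1 j) = z.2 ord0 j.
Proof. exact: row_mxEr. Qed.

Lemma measurable_subrV n :
  measurable_fun [set: 'rV[R]_n * 'rV[R]_n] (fun z => (z.1 - z.2)%R).
Proof.
apply: measurable_fun_coordP => i.
rewrite [X in measurable_fun _ X](_ : _ =
    (fun z : 'rV[R]_n * 'rV[R]_n => z.1 ord0 i - z.2 ord0 i)%R); last first.
  by apply/funext => z; rewrite !mxE.
by apply: measurable_funB; apply: measurableT_comp (measurable_coord i) _.
Qed.

Lemma measurable_addrV n :
  measurable_fun [set: 'rV[R]_n * 'rV[R]_n] (fun z => (z.1 + z.2)%R).
Proof.
apply: measurable_fun_coordP => i.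
rewrite [X in measurable_fun _ X](_ : _ =
    (fun z : 'rV[R]_n * 'rV[R]_n => z.1 ord0 i + z.2 ord0 i)%R); last first.
  by apply/funext => z; rewrite !mxE.
by apply: measurable_funD; apply: measurableT_comp (measurable_coord i) _.
Qed.

Lemma measurable_translation n (a : 'rV[R]_n) :
  measurable_fun [set: 'rV[R]_n] (fun y => (y + a)%R).
Proof.
exact: (measurableT_comp (@measurable_addrV n) (@measurable_pair2 _ _ _ _ a)).
Qed.

Lemma measurable_reflection n (a : 'rV[R]_n) :
  measurable_fun [set: 'rV[R]_n] (fun y => (a - y)%R).
Proof.
exact: (measurableT_comp (@measurable_subrV n) (@measurable_pair1 _ _ _ _ a)).
Qed.

Let measurable_reflectionR (a : R) : measurable_fun [set: measurableTypeR R]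
  (fun y : measurableTypeR R => (a - y)%R : measurableTypeR R).
Proof. exact: (@measurable_funB _ _ R setT (cst a) id). Qed.

Lemma lebesgue_measure_reflection (a : R) (A : set (measurableTypeR R)) :
  measurable A ->
  pushforward (@lebesgue_measure R)
    (fun y : measurableTypeR R => (a - y)%R : measurableTypeR R) A =
  lebesgue_measure A.
Proof.
have m := measurable_reflectionR a.
move=> mA; apply/esym/lebesgue_measure_unique => //= _ [[b c]] _ <-.
rewrite /pushforward (_ : _ @^-1` _ = `[(a - c)%R, (a - b)%R[%classic).
  rewrite !lebesgue_measure_itv/= !lte_fin ltrD2l ltrN2 -!EFinB.
  by case: ifP => // _; congr (_%:E); ring.
apply/seteqP; split => y /=; rewrite !in_itv/= => /andP[h1 h2]; apply/andP;
  by split; lra.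
Qed.

(** By Fubini, from the invariance of each factor. Point reflections are the only
    isometries proved invariant from scratch: a translation is the composite
    of two of them. *)
Lemma product_lebesgue_reflection n (a : 'rV[R]_n) (A : set 'rV[R]_n) :
  measurable A ->
  product_lebesgue R n ((fun y => (a - y)%R) @^-1` A) = product_lebesgue R n A.
Proof.
elim: n a A => [|n IH] a A mA.
  have E (x y : 'rV[R]_0) : x = y by rewrite [x]thinmx0 [y]thinmx0.
  by congr (_ _); apply/seteqP; split => y /=; rewrite (E (a - y)%R y).
pose mu := product_lebesgue R n.
rewrite /= /cons_measure /pushforward.
pose B := @cons_rV R n @^-1` A.
have mB : measurable B.
  by rewrite -[X in measurable X]setTI; exact: measurable_cons_rV.
pose phi x := mu (xsection B x).
have mphi : measurable_fun setT phi by exact: measurable_fun_xsection.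
pose a0 := a ord0 ord0; pose a' : 'rV[R]_n := (\row_(j < n) a ord0 (lift ord0 j))%R.
have sub_cons x (y : 'rV[R]_n) : (a - cons_rV (x, y) = cons_rV ((a0 - x)%R : measurableTypeR R, (a' - y)%R))%R.
  apply/rowP => i; case: (split_ordP (i : 'I_(1 + n))) => j ->.
    rewrite !cons_rV_head [LHS]mxE [X in (_ + X)%R]mxE cons_rV_head.
    by congr (a _ _ - _)%R; apply/val_inj; rewrite /= ord1.
  rewrite !cons_rV_tail [LHS]mxE [X in (_ + X)%R]mxE cons_rV_tail !mxE.
  by congr (a _ _ - _)%R; apply/val_inj.
rewrite /product_measure1 /=.
transitivity (\int[lebesgue_measure]_x phi (a0 - x)%R).
  apply: eq_integral => x _ /=; rewrite /phi -[RHS](IH a'); last exact: measurable_xsection.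
  congr (_ _); apply/seteqP.
  by split => y /=; rewrite !xsectionE /B /= sub_cons.
exact: (ge0_integral_measure_preserving (measurable_reflectionR a0)
  (@lebesgue_measure_reflection a0)).
Qed.

Section lebesgue_rV_invariance.
Context (d : nat).
Local Notation V := 'rV[R]_d.
Local Notation vol := (@lebesgue_rV R d).

Lemma lebesgue_rV_reflection (a : V) (A : set V) : measurable A ->
  vol ((fun y => (a - y)%R) @^-1` A) = vol A.
Proof.
move=> mA; rewrite !lebesgue_rVE//; first exact: product_lebesgue_reflection.
by rewrite -[X in measurable X]setTI; exact: measurable_reflection.
Qed.

Lemma ge0_integral_reflection (a : V) (f : V -> \bar R) :
  measurable_fun [set: V] f -> (forall x, 0 <= f x) ->
  \int[vol]_y f (a - y)%R = \int[vol]_y f y.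
Proof.
move=> mf f0.
exact: (ge0_integral_measure_preserving (measurable_reflection a)
  (lebesgue_rV_reflection a)).
Qed.

Lemma ge0_integral_translation (a : V) (f : V -> \bar R) :
  measurable_fun [set: V] f -> (forall x, 0 <= f x) ->
  \int[vol]_y f (y - a)%R = \int[vol]_y f y.
Proof.
move=> mf f0; rewrite -(ge0_integral_reflection (- a) mf f0).
rewrite -(@ge0_integral_reflection 0 (fun y => f (- a - y)%R))//.
  by apply: eq_integral => y _; rewrite sub0r opprK addrC.
exact: measurableT_comp mf (@measurable_reflection _ _).
Qed.

Lemma lebesgue_rV_translation (a : V) (A : set V) : measurable A ->
  vol ((fun y => (y - a)%R) @^-1` A) = vol A.
Proof.
move=> mA.
rewrite -(lebesgue_rV_reflection (- a) mA).
rewrite -[RHS](lebesgue_rV_reflection 0).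
  by rewrite -comp_preimage; congr (vol _); apply/seteqP; split => y /=;
    rewrite sub0r opprK addrC.
rewrite -[X in measurable X]setTI; exact: measurable_reflection.
Qed.

End lebesgue_rV_invariance.

Lemma lebesgue_rV_box d (I : set (measurableTypeR R)) : measurable I ->
  lebesgue_rV [set x : 'rV[R]_d | forall i, I (x ord0 i)] =
  lebesgue_measure I ^+ d.
Proof.
move=> mI.
have mbox n : measurable [set x : 'rV[R]_n | forall i, I (x ord0 i)].
  rewrite (_ : [set _ | _] = \bigcap_(i in [set: 'I_n])
      ((fun x : 'rV[R]_n => x ord0 i) @^-1` I)).
    apply: fin_bigcap_measurable => // i _.
    rewrite -[X in measurable X]setTI; exact: measurable_coord.
  by apply/seteqP; split => x /= h i; [move=> _; exact: h|exact: (h i Logic.I)].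
rewrite lebesgue_rVE//; elim: d => [|n IH].
  by rewrite expe0 /= diracE mem_set// => -[].
rewrite expeS -IH /= /cons_measure /pushforward (_ : _ @^-1` _ =
    I `*` [set x : 'rV[R]_n | forall i, I (x ord0 i)]).
  by rewrite product_measure1E//; exact: mbox.
apply/seteqP; split => -[x y] /=.
  move=> h; split => [|i].
    by have := h (@lshift 1 n ord0); rewrite cons_rV_head.
  by have := h (rshift 1 i); rewrite cons_rV_tail.
move=> [Ix Iy] i; case: (split_ordP (i : 'I_(1 + n))) => j ->.
  by rewrite cons_rV_head.
by rewrite cons_rV_tail.
Qed.

Lemma lebesgue_rV_hyperplane n (c : R) :
  lebesgue_rV [set x : 'rV[R]_n.+1 | x ord0 ord0 = c] = 0.
Proof.
have m : measurable [set x : 'rV[R]_n.+1 | x ord0 ord0 = c].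
  rewrite -[X in measurable X]setTI.
  exact: (@measurable_coord R n.+1 ord0 measurableT [set c]).
rewrite lebesgue_rVE// /= /cons_measure /pushforward (_ : _ @^-1` _ =
    [set c] `*` [set: 'rV[R]_n]).
  have mc : measurable ([set c] : set (measurableTypeR R)) by exact: measurable_set1.
  rewrite product_measure1E//.
  by rewrite /= (lebesgue_measure_set1 c) mul0e.
apply/seteqP; split => -[x y] /=.
  by rewrite (_ : ord0 = @lshift 1 n ord0) ?cons_rV_head//; exact/val_inj.
move=> [-> _].
by rewrite (_ : ord0 = @lshift 1 n ord0) ?cons_rV_head//; exact/val_inj.
Qed.

Section eball.
Context (d : nat).
Local Notation V := 'rV[R]_d.
Local Notation vol := (@lebesgue_rV R d).

Lemma measurable_eball r : measurable (@eball R d r).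
Proof.
have me : measurable_fun [set: V] (@enorm R d).
  have ms : measurable_fun [set: V] (fun x : V => \sum_(i < d) x ord0 i ^+ 2)%R.
    by apply: measurable_sum => i; apply: measurable_funX; exact: measurable_coord.
  exact: (measurableT_comp (continuous_measurable_fun (@sqrt_continuous R)) ms).
rewrite -[X in measurable X]setTI.
rewrite (_ : eball r = @enorm R d @^-1` `]-oo, r[%classic); last first.
  by apply/seteqP; split => x /=; rewrite in_itv.
exact: me.
Qed.

Lemma eball_bounded : vol (eball 1) < +oo.
Proof.
(* The unit ball lies in the cube of side 2. *)
pose I : set (measurableTypeR R) := `[(-1)%R, 1%R]%classic.
apply: (@le_lt_trans _ _ (vol [set x : V | forall i, I (x ord0 i)])).
  apply: le_mu_ext => x; rewrite /eball/= /enorm => x1 i.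
  rewrite /I/= in_itv/= -ler_norml.
  have : (x ord0 i ^+ 2 <= 1)%R.
    rewrite (@le_trans _ _ (\sum_(i < d) x ord0 i ^+ 2)%R)//.
      by rewrite (bigD1 i)//= lerDl sumr_ge0// => j _; exact: sqr_ge0.
    rewrite -(ler_sqrt _ ler01) sqrtr1; exact: ltW.
  by rewrite -[in X in X -> _]real_normK ?num_real// expr_le1.
have lI : @lebesgue_measure R I = (1 - - 1)%:E.
  apply: etrans (lebesgue_measure_itv _) _; rewrite /= lte_fin.
  by have -> : (-1 < 1 :> R)%R by lra.
rewrite lebesgue_rV_box ?lI -?EFin_expe ?ltry//.
exact: measurable_itv.
Qed.

Lemma eball_gt0 : 0 < vol (eball 1).
Proof.
(* The cube of side 1 / (d + 1) lies in the unit ball: the squares of its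
   coordinates add up to at most d / (d + 1). *)
pose e : R := (d.+1%:R^-1)%R.
have e0 : (0 < e)%R by rewrite invr_gt0.
pose I : set (measurableTypeR R) := `[0%R, e]%classic.
apply: (@lt_le_trans _ _ (vol [set x : V | forall i, I (x ord0 i)])).
  have lI : @lebesgue_measure R I = e%:E.
    by apply: etrans (lebesgue_measure_itv _) _; rewrite /= lte_fin e0 -EFinB subr0.
  rewrite lebesgue_rV_box ?lI ?expe_gt0 ?lte_fin//; exact: measurable_itv.
apply: le_mu_ext => x/= Ix; rewrite /eball/= /enorm -sqrtr1 ltr_sqrt//.
apply: (@le_lt_trans _ _ (\sum_(i < d) e)%R).
  apply: ler_sum => i _; have := Ix i; rewrite /I/= in_itv/= => /andP[x0 xe].
  have e1 : (e <= 1)%R by rewrite invf_le1// ler1n.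
  by rewrite (le_trans _ xe)// expr2 ler_piMr// (le_trans xe).
by rewrite sumr_const card_ord -[X in (X < _)%R]mulr_natl ltr_pdivrMr// mul1r ltr_nat.
Qed.
End eball.

(** The open sets are those of the product topology; an open set is a countable
    union of boxes with rational centre and radius 1 / (k + 1). *)
Lemma open_measurable_rV d (A : set 'rV[R]_d) : open A -> measurable A.
Proof.
move=> oA.
pose box (z : 'rV[rat]_d * nat) : set 'rV[R]_d :=
  [set x | forall i, (`|x ord0 i - ratr (z.1 ord0 i)| < z.2.+1%:R^-1)%R].
have mbox z : measurable (box z).
  rewrite (_ : box z = \bigcap_(i in [set: 'I_d])
      ((fun x : 'rV[R]_d => `|x ord0 i - ratr (z.1 ord0 i)|)%R @^-1` `]-oo, z.2.+1%:R^-1%R[%classic)).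
    apply: fin_bigcap_measurable => // i _.
    rewrite -[X in measurable X]setTI.
    have mf : measurable_fun [set: 'rV[R]_d] (fun x : 'rV[R]_d => `|x ord0 i - ratr (z.1 ord0 i)|)%R.
      apply: measurableT_comp => //; apply: measurable_funB => //.
      exact: measurable_coord.
    exact: mf.
  by apply/seteqP; split => x /= h i; [move=> _|have := h i Logic.I]; rewrite /= in_itv/=.
have -> : A = \bigcup_z (if `[< box z `<=` A >] then box z else set0).
  apply/seteqP; split => [x Ax|x [z _]]; last by case: asboolP => // zA; exact: zA.
  have /nbhs_ballP[e /= e0 xA] := open_nbhs_nbhs (conj oA Ax).
  have [n ne] : exists n : nat, (n.+1%:R^-1 < e / 2)%R.
    by apply: exists_natSinv_lt; rewrite divr_gt0.
  have /choice[c cx] : forall i, exists c : rat, (`|x ord0 i - ratr c| < n.+1%:R^-1)%R.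
    move=> i; have [|c] := @rat_in_itvoo R (x ord0 i - n.+1%:R^-1) (x ord0 i + n.+1%:R^-1).
      by rewrite ltrBlDr -addrA ltrDl addr_gt0.
    by rewrite in_itv/= => h; exists c; rewrite ltr_distlC.
  exists (\row_i c i, n)%R => //; case: asboolP => [_ i|[]].
    by rewrite /= mxE; exact: cx.
  move=> y /= yc; apply: xA; split => // i j; rewrite (ord1 i) /ball/=.
  have := yc j; have := cx j; rewrite mxE => h1 h2.
  rewrite -(subrKA (ratr (c j))) (le_lt_trans (ler_normD _ _))//.
  by rewrite [X in (_ + X)%R]distrC (splitr e) ltrD// (lt_trans _ ne).
apply: countable_bigcupT_measurable => [|z]; first exact: countableP.
by case: ifP.
Qed.

End lebesgue_rV_theory.

(** * Tails of atomless measures *)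

Section density_measure.
Context d (T : measurableType d) (R : realType) (mu : {measure set T -> \bar R}).
Variable f : T -> \bar R.
Hypotheses (mf : measurable_fun [set: T] f) (f0 : forall x, 0 <= f x).

Definition density (A : set T) : \bar R := \int[mu]_(x in A) f x.

Let density0 : density set0 = 0.
Proof. exact: integral_set0. Qed.

Let density_ge0 A : 0 <= density A.
Proof. exact: integral_ge0. Qed.

Let density_sigma_additive : semi_sigma_additive density.
Proof.
move=> F mF tF mUF; rewrite /density ge0_integral_bigcup//.
  by apply: is_cvg_nneseries => n _ _; exact: integral_ge0.
exact: measurable_funTS.
Qed.

HB.instance Definition _ := isMeasure.Build _ _ _ density
  density0 density_ge0 density_sigma_additive.

Definition density_measure : {measure set T -> \bar R} := density.

End density_measure.

Section small_tail.
Context d (T : measurableType d) (R : realType) (mu : {measure set T -> \bar R}).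
Variable X : T -> R.
Hypothesis mX : measurable_fun [set: T] X.
Hypothesis X_atomless : forall c, mu [set x | X x = c] = 0.
Hypotheses (mu_gt0 : 0 < mu setT) (mu_fin : mu setT < +oo).

Let mtail r : measurable [set x | (r < X x)%R].
Proof.
rewrite -[X in measurable X]setTI (_ : [set _ | _] = X @^-1` `]r, +oo[%classic).
  exact: mX.
by apply/seteqP; split => x /=; rewrite in_itv/= andbT.
Qed.

Let tail_le r s : (r <= s)%R -> mu [set x | (s < X x)%R] <= mu [set x | (r < X x)%R].
Proof. by move=> rs; apply: le_measure; rewrite ?inE// => x /=; exact: le_lt_trans. Qed.

(** When X has no atoms the tail mass of r < X is continuous in r, so it cannot
    jump from a positive value to 0. *)
Lemma small_tail (e : \bar R) : 0 < e ->
  exists r : R, 0 < mu [set x | (r < X x)%R] < e.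
Proof.
move=> e0; apply: contrapT => /forallNP noT.
have big r : 0 < mu [set x | (r < X x)%R] -> e <= mu [set x | (r < X x)%R].
  by move=> r0; rewrite leNgt; apply/negP => re; apply: (noT r); rewrite r0.
pose S := [set r : R | 0 < mu [set x | (r < X x)%R]].
have nullU (r_ : nat -> R) (A : set T) : A `<=` \bigcup_n [set x | (r_ n < X x)%R] ->
    (forall n, ~ S (r_ n)) -> mu.-negligible A.
  move=> AU rS; apply: (negligibleS AU); apply: negligible_bigcup => n.
  apply/negligibleP => //; apply/eqP; rewrite eq_le measure_ge0 andbT leNgt.
  exact/negP/rS.
(* If no tail had mass in ]0, e[, every nonnull tail would weigh at least e, and
   this survives intersections. *)
have bigI (r_ : nat -> R) : nondecreasing_seq r_ -> (forall n, S (r_ n)) ->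
    e <= mu (\bigcap_n [set x | (r_ n < X x)%R]).
  move=> ndr rS.
  pose A n := [set x | (r_ n < X x)%R].
  have mA n : measurable (A n) by exact: mtail.
  have cvgA : (mu \o A) n @[n --> \oo] --> mu (\bigcap_n A n).
    apply: nonincreasing_cvg_mu => //.
    - by apply: le_lt_trans mu_fin; apply: le_measure; rewrite ?inE.
    - exact: bigcapT_measurable.
    - move=> m n mn; apply/subsetPset => x /=; apply: le_lt_trans; exact: ndr.
  rewrite -(cvg_lim _ cvgA)//; apply: lime_ge; first by apply/cvg_ex; eexists; exact: cvgA.
  by apply: nearW => n; exact/big/rS.
have S0 : S !=set0.
  apply: contrapT => /nonemptyPn S0.
  suff /negligibleP mu0 : mu.-negligible [set: T] by move: mu_gt0; rewrite mu0// ltxx.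
  apply: (@nullU (fun n => - n%:R)%R) => [x _|n]; last by rewrite S0.
  exists (Num.truncn (- X x)).+1 => //=.
  by rewrite ltrNl; exact: truncnS_gt.
have down r s : (r < s)%R -> S s -> S r.
  by move=> rs; rewrite /S/= => /lt_le_trans; apply; exact/tail_le/ltW.
have [ubS|nubS] := pselect (has_ubound S); last first.
  have Sn n : S n%:R.
    apply: contrapT => Sn; apply: nubS; exists n%:R => r Sr.
    by rewrite leNgt; apply/negP => nr; apply: Sn; exact: down Sr.
  have : e <= mu (\bigcap_n [set x | (n%:R < X x)%R]).
    by apply: bigI Sn => m n mn; rewrite ler_nat.
  rewrite (_ : \bigcap_n _ = set0) ?measure0 ?leNgt ?e0//.
  rewrite -subset0 => x /= /(_ (Num.truncn (X x)).+1 Logic.I)/=.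
  by apply/negP; rewrite -leNgt ltW// truncnS_gt.
(* Beyond l = sup S the tails are null, so {l <= X} is null because X has no
   atom at l; yet it is an intersection of nonnull tails. *)
pose l := sup S.
have Sl r : (r < l)%R -> S r by move=> /(sup_gt S0)[s Ss rs]; exact: down Ss.
have : e <= mu (\bigcap_n [set x | (l - n.+1%:R^-1 < X x)%R]).
  apply: (bigI (fun n => l - n.+1%:R^-1)%R) => [m n mn|n].
    by rewrite lerD2l lerN2 lef_pV2 ?posrE// ler_nat ltnS.
  by apply: Sl; rewrite ltrBlDr ltrDl.
suff /measure_negligible -> : mu.-negligible (\bigcap_n [set x | (l - n.+1%:R^-1 < X x)%R]).
- by rewrite leNgt e0.
- by apply: bigcapT_measurable => n; exact: mtail.
apply: (@negligibleS _ _ _ _ ([set x | X x = l] `|` [set x | (l < X x)%R])).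
  move=> x /= lx; have [|] := ltrP l (X x); first by right.
  left; apply/eqP; rewrite eq_le; apply/andP; split => //.
  rewrite leNgt; apply/negP => xl.
  have [n nx] := @exists_natSinv_lt _ (l - X x)%R ltac:(by rewrite subr_gt0).
  by have /= := lx n Logic.I; apply/negP; rewrite -leNgt lerBrDr -lerBrDl ltW.
apply: negligibleU.
  apply/negligibleP; last exact: X_atomless.
  rewrite -[X in measurable X]setTI; exact: (mX measurableT (measurable_set1 l)).
apply: (@nullU (fun n => l + n.+1%:R^-1)%R) => [x /= lx|n Sn].
  have [n nx] := @exists_natSinv_lt _ (X x - l)%R ltac:(by rewrite subr_gt0).
  by exists n => //=; rewrite -ltrBrDl.
have := ub_le_sup ubS Sn; rewrite -/l leNgt => /negP; apply.
by rewrite ltrDl.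
Qed.
End small_tail.

(** * Convolution *)

Section convolution.
Context (R : realType) (d : nat).
Local Notation V := 'rV[R]_d.
Local Notation vol := (@lebesgue_rV R d).
Implicit Types f g w : V -> \bar R.

Lemma measurable_convolution_integrand f g :
  measurable_fun setT f -> measurable_fun setT g ->
  measurable_fun setT (fun z : V * V => f (z.1 - z.2)%R * g z.2).
Proof.
move=> mf mg; apply: emeasurable_funM.
  exact: measurableT_comp mf (@measurable_subrV R d).
exact: measurableT_comp mg (@measurable_snd _ _ _ _).
Qed.

Lemma measurable_convolution f g :
  measurable_fun setT f -> measurable_fun setT g ->
  (forall x, 0 <= f x) -> (forall x, 0 <= g x) ->
  measurable_fun setT (convolution f g).
Proof.
move=> mf mg f0 g0.
have := @measurable_fun_fubini_tonelli_F _ _ V V R vol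
  (fun z => f (z.1 - z.2)%R * g z.2) (measurable_convolution_integrand mf mg).
apply => z; exact: mule_ge0.
Qed.

Lemma convolution_ge0 f g x :
  (forall x, 0 <= f x) -> (forall x, 0 <= g x) -> 0 <= convolution f g x.
Proof. by move=> f0 g0; apply: integral_ge0 => y _; exact: mule_ge0. Qed.

(** Tonelli and the substitution x = b + y. With w = 1 it computes the mass of a
    convolution, with w the indicator of the zero set of f * g it describes the
    support, and with w the energy of increments it drives the iteration. *)
Lemma integral_mul_convolution w f g :
  measurable_fun setT w -> measurable_fun setT f -> measurable_fun setT g ->
  (forall x, 0 <= w x) -> (forall x, 0 <= f x) -> (forall x, 0 <= g x) ->
  \int[vol]_x (w x * convolution f g x) =
  \int[vol]_y (g y * \int[vol]_b (w (b + y)%R * f b)).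
Proof.
move=> mw mf mg w0 f0 g0; have mfg := measurable_convolution_integrand mf mg.
transitivity (\int[vol]_x \int[vol]_y (w x * (f (x - y)%R * g y))).
  apply: eq_integral => x _; rewrite ge0_integralZl//.
    exact: measurableT_comp mfg (@measurable_pair1 _ _ _ _ x).
  by move=> y _; exact: mule_ge0.
rewrite (@fubini_tonelli _ _ V V R vol vol (fun z : V * V => w z.1 * (f (z.1 - z.2)%R * g z.2))); last first.
- by move=> z; rewrite !mule_ge0.
- apply: emeasurable_funM => //; exact: measurableT_comp mw (@measurable_fst _ _ _ _).
apply: eq_integral => y _ /=.
have msub := measurable_translation (- y)%R; have madd := measurable_translation y.
transitivity (\int[vol]_x (g y * (w x * f (x - y)%R))).
  by apply: eq_integral => x _; rewrite muleA muleC.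
rewrite ge0_integralZl//; last 2 first.
- by apply: emeasurable_funM => //; exact: measurableT_comp mf msub.
- by move=> x _; exact: mule_ge0.
congr (_ * _).
rewrite -(@ge0_integral_translation _ _ y (fun b => w (b + y)%R * f b)); last 2 first.
- by apply: emeasurable_funM => //; exact: measurableT_comp mw madd.
- by move=> x; exact: mule_ge0.
by apply: eq_integral => x _; rewrite subrK.
Qed.

Lemma integral_convolution f g :
  measurable_fun setT f -> measurable_fun setT g ->
  (forall x, 0 <= f x) -> (forall x, 0 <= g x) ->
  \int[vol]_x convolution f g x = \int[vol]_x f x * \int[vol]_x g x.
Proof.
move=> mf mg f0 g0.
have := @integral_mul_convolution (cst 1) f g _ mf mg _ f0 g0.
under eq_integral do rewrite mul1e.
move=> -> //.
under eq_integral do under eq_integral do rewrite mul1e.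
under eq_integral do rewrite muleC.
by rewrite ge0_integralZl// integral_ge0.
Qed.

Lemma convolution_le f g (M : \bar R) x :
  measurable_fun setT f -> measurable_fun setT g ->
  (forall x, 0 <= f x) -> (forall x, 0 <= g x) -> (forall x, f x <= M) ->
  convolution f g x <= M * \int[vol]_x g x.
Proof.
move=> mf mg f0 g0 fM; rewrite /convolution -ge0_integralZl//; last first.
  exact: le_trans (f0 0%R) (fM 0%R).
apply: ge0_le_integral => //.
- by move=> y _; exact: mule_ge0.
- exact: measurableT_comp (measurable_convolution_integrand mf mg) (@measurable_pair1 _ _ _ _ x).
- exact: emeasurable_funM.
- by move=> y _; exact: lee_wpmul2r.
Qed.

Lemma convolutionN f g x :
  measurable_fun setT f -> measurable_fun setT g ->
  (forall x, 0 <= f x) -> (forall x, 0 <= g x) ->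
  (forall x, f (- x)%R = f x) -> (forall x, g (- x)%R = g x) ->
  convolution f g (- x)%R = convolution f g x.
Proof.
move=> mf mg f0 g0 fN gN; rewrite /convolution.
rewrite -(@ge0_integral_reflection _ _ 0%R (fun y => f (x - y)%R * g y)); last 2 first.
- exact: measurableT_comp (measurable_convolution_integrand mf mg) (@measurable_pair1 _ _ _ _ x).
- by move=> y; exact: mule_ge0.
by apply: eq_integral => y _; rewrite sub0r opprK gN -[in RHS]fN opprD.
Qed.

End convolution.

(** * Convolution squares take arbitrarily small positive values *)

Section kernel.
Context (R : realType) (d : nat).
Local Notation V := 'rV[R]_d.
Local Notation vol := (@lebesgue_rV R d).

(** The class of weights to which the truncation of nu belongs and which is
    stable under f |-> f * f. *)
Record kernel (f : V -> \bar R) : Prop := Kernel {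
  kernel_measurable : measurable_fun [set: V] f ;
  kernel_ge0 : forall x, 0 <= f x ;
  kernelN : forall x, f (- x)%R = f x ;
  kernel_gt0 : 0 < \int[vol]_x f x ;
  kernel_lty : \int[vol]_x f x < +oo ;
  kernel_bounded : exists M : R, forall x, f x <= M%:E }.

Lemma kernel_convolution (f : V -> \bar R) :
  kernel f -> kernel (convolution f f).
Proof.
move=> [mf f0 fN fgt flt [M fM]].
have M0 : 0 <= M%:E := le_trans (f0 0%R) (fM 0%R).
split.
- exact: measurable_convolution.
- by move=> x; exact: convolution_ge0.
- by move=> x; exact: convolutionN.
- by rewrite integral_convolution// mule_gt0.
- by rewrite integral_convolution//; apply: lte_mul_pinfty; rewrite ?ge0_fin_numE// ltW.
- exists (fine (M%:E * \int[vol]_x f x)) => x.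
  rewrite fineK; first exact: convolution_le.
  by rewrite fin_numM// ge0_fin_numE// ltW.
Qed.

Lemma kernel_support_gt0 (f : V -> \bar R) :
  kernel f -> 0 < vol [set x | 0 < f x].
Proof.
move=> [mf f0 _ fgt _ _].
rewrite lt0e measure_ge0 andbT; apply/eqP => A0.
move: fgt; rewrite (_ : \int[vol]_x f x = 0) ?ltxx//.
transitivity (\int[vol]_x `|f x|).
  by apply: eq_integral => x _; rewrite gee0_abs.
apply/ae_eq_integral_abs => //; exists [set x | 0 < f x]; split => //.
  by rewrite -[X in measurable X]setTI; exact: emeasurable_fun_o_infty.
by move=> x /= /not_implyP[_ /eqP fx0]; rewrite lt0e fx0 f0.
Qed.

End kernel.

Section halfspace.
Context (R : realType) (n : nat).
Local Notation V := 'rV[R]_n.+1.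
Local Notation vol := (@lebesgue_rV R n.+1).

Let X (x : V) : R := x ord0 ord0.

Let mX : measurable_fun [set: V] X.
Proof. exact: measurable_coord. Qed.

Definition halfspace (r : R) : set V := [set x | (r < x ord0 ord0)%R].

Lemma measurable_halfspace r : measurable (halfspace r).
Proof.
rewrite -[X in measurable X]setTI (_ : halfspace r = X @^-1` `]r, +oo[%classic).
  exact: mX.
by apply/seteqP; split => x /=; rewrite in_itv/= andbT.
Qed.

Lemma small_halfspace_integral (f : V -> \bar R) (e : \bar R) :
  measurable_fun [set: V] f -> (forall x, 0 <= f x) ->
  0 < \int[vol]_x f x -> \int[vol]_x f x < +oo -> 0 < e ->
  exists r : R, 0 < \int[vol]_(x in halfspace r) f x < e.
Proof.
move=> mf f0 fgt flt e0.
apply: (@small_tail _ _ _ (density_measure vol mf f0) X) => // c.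
have mc : measurable [set x | X x = c].
  rewrite -[X in measurable X]setTI; exact: (mX measurableT (measurable_set1 c)).
rewrite /density_measure/= /density -(@integral_abs_eq0 _ _ _ vol _ f mc)//.
- by apply: eq_integral => x _; rewrite gee0_abs.
- exact: measurable_funTS.
- exact: lebesgue_rV_hyperplane.
Qed.

(** This replaces the continuity of convolutions. Let T be the mass of f on the
    half-space x_1 > r. If x_1 > 2r, then y or x - y lies in that half-space, so
    f * f <= 2 T sup f on x_1 > 2r; and f * f has mass at least T^2 there. Since
    hyperplanes are null, T can be chosen positive and as small as desired. *)
Lemma integral_sublevel_convolution_gt0 (f : V -> \bar R) (s : R) :
  kernel f -> (0 < s)%R ->
  0 < \int[vol]_(x in [set x | convolution f f x < s%:E]) convolution f f x.
Proof.
move=> kf s0; have kff := kernel_convolution kf.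
have [mff ff0 _ _ _ _] := kff.
case: kf => mf f0 fN fgt flt [M0 fM0].
pose M : R := (`|M0| + 1)%R.
have Mgt0 : (0 < M)%R by rewrite ltr_wpDl.
have fM x : f x <= M%:E.
  by apply: le_trans (fM0 x) _; rewrite lee_fin (le_trans (ler_norm _))// lerDl.
have e0 : 0 < (s / (M + M))%:E by rewrite lte_fin divr_gt0// addr_gt0.
have [r /andP[Tgt Tlt]] := small_halfspace_integral mf f0 fgt flt e0.
pose fr := f \_ (halfspace r).
have fr0 x : 0 <= fr x by rewrite /fr patchE; case: ifP.
have mfr : measurable_fun [set: V] fr.
  apply/(measurable_restrictT _ _).1; first exact: measurable_halfspace.
  exact: measurable_funTS.
rewrite integral_mkcond -/fr in Tgt Tlt.
have small x : halfspace (r + r) x -> convolution f f x < s%:E.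
  move=> rx.
  have mfrx : measurable_fun [set: V] (fun y => fr (x - y)%R).
    exact: measurableT_comp mfr (measurable_reflection x).
  have : convolution f f x <= \int[vol]_y (M%:E * fr y + M%:E * fr (x - y)%R).
    apply: ge0_le_integral => //.
    - by move=> y _; exact: mule_ge0.
    - exact: measurableT_comp (measurable_convolution_integrand mf mf) (@measurable_pair1 _ _ _ _ x).
    - by apply: emeasurable_funD; exact: emeasurable_funM.
    - move=> y _; have [ry|yr] := boolP (y \in halfspace r).
        rewrite -[leLHS]adde0 leeD//; last by rewrite mule_ge0// lee_fin ltW.
        by rewrite /fr patchE ry lee_wpmul2r.
      have xy : (x - y)%R \in halfspace r.
        move: yr rx; rewrite notin_setE /halfspace/= => /negP; rewrite -leNgt => yr rx.
        apply/mem_set => /=; rewrite !mxE.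
        by rewrite ltrBrDl (le_lt_trans _ rx)// lerD2r.
      rewrite -[leLHS]add0e leeD//; first by rewrite mule_ge0// lee_fin ltW.
      by rewrite /fr !patchE xy muleC lee_wpmul2r.
  move=> /le_lt_trans; apply.
  rewrite ge0_integralD//; last 4 first.
  - by move=> y _; rewrite mule_ge0// lee_fin ltW.
  - exact: emeasurable_funM.
  - by move=> y _; rewrite mule_ge0// lee_fin ltW.
  - exact: emeasurable_funM.
  rewrite !ge0_integralZl//; try by rewrite lee_fin ltW.
  rewrite (ge0_integral_reflection x mfr fr0).
  have : \int[vol]_y fr y \is a fin_num.
    by rewrite ge0_fin_numE ?ltW// (lt_trans Tlt)// ltry.
  move: Tlt => /[swap] /fineK <-; rewrite lte_fin -!EFinM -EFinD lte_fin.
  by rewrite (ltr_pdivlMr _ _ (addr_gt0 Mgt0 Mgt0)) mulrC mulrDl.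
apply: (@lt_le_trans _ _ (\int[vol]_x convolution fr fr x)).
  by rewrite integral_convolution// mule_gt0.
rewrite [leRHS]integral_mkcond; apply: ge0_le_integral => //.
- by move=> x _; exact: convolution_ge0.
- exact: measurable_convolution.
- apply/(measurable_restrictT _ _).1; last exact: measurable_funTS.
  rewrite -[X in measurable X]setTI; exact: emeasurable_fun_infty_o.
move=> x _; rewrite patchE; case: ifPn => [_|/negP xs].
  apply: ge0_le_integral => //.
  - by move=> y _; exact: mule_ge0.
  - exact: measurableT_comp (measurable_convolution_integrand mfr mfr) (@measurable_pair1 _ _ _ _ x).
  - exact: measurableT_comp (measurable_convolution_integrand mf mf) (@measurable_pair1 _ _ _ _ x).
  - by move=> y _; rewrite lee_pmul// /fr patchE; case: ifP.
rewrite /convolution integral0_eq// => y _; apply/eqP; rewrite mule_eq0.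
apply: contraT; rewrite /fr !patchE negb_or.
case: ifPn => [xy|]; last by rewrite eqxx.
case: ifPn => [yr|]; last by rewrite eqxx andbF.
move=> _; exfalso; apply: xs; apply/mem_set => /=; apply: small.
move: xy yr => /set_mem + /set_mem; rewrite /halfspace/= !mxE => h1 h2.
have := ltrD h1 h2; by rewrite subrK.
Qed.

End halfspace.

(** * The support of a convolution square is substantially larger *)

Section support_growth.
Context (R : realType) (n : nat).
Local Notation V := 'rV[R]_n.+1.
Local Notation vol := (@lebesgue_rV R n.+1).

Let pos_set (f : V -> \bar R) : set V := [set x | 0 < f x].

Let measurable_pos_set f : measurable_fun [set: V] f -> measurable (pos_set f).
Proof.
by move=> mf; rewrite -[X in measurable X]setTI; exact: emeasurable_fun_o_infty.
Qed.

(** For almost every a where f is positive, the support of f * f contains the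
    translate by a of the support of f up to a null set: otherwise f * f would
    have positive mass on its own zero set. *)
Lemma ae_support_translate (f : V -> \bar R) : kernel f ->
  {ae vol, forall a, 0 < f a ->
    vol ([set b | 0 < f b] `&` [set b | convolution f f (b + a)%R = 0]) = 0}.
Proof.
move=> kf; have [mh h0 _ _ _ _] := kernel_convolution kf.
have [mf f0 _ _ _ _] := kf.
pose h := convolution f f.
have mB : measurable [set x | h x = 0].
  rewrite -[X in measurable X]setTI; exact: (mh measurableT [set 0]).
pose w (x : V) : \bar R := (\1_[set x | h x = 0] x)%:E.
have mw : measurable_fun [set: V] w by apply/measurable_EFinP; exact: measurable_indic.
have w0 x : 0 <= w x by rewrite lee_fin.
have mwf a : measurable_fun [set: V] (fun b => w (b + a)%R * f b).
  by apply: emeasurable_funM => //; exact: measurableT_comp mw (measurable_translation a).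
have mG : measurable_fun [set: V] (fun y => f y * \int[vol]_b (w (b + y)%R * f b)).
  apply: emeasurable_funM => //.
  apply: (@measurable_fun_fubini_tonelli_F _ _ V V R vol
    (fun z : V * V => w (z.2 + z.1)%R * f z.2)) => [|z]; last exact: mule_ge0.
  have madd : measurable_fun [set: V * V] (fun z : V * V => z.2 + z.1)%R.
    rewrite (_ : (fun _ => _) = (fun z : V * V => z.1 + z.2)%R).
      exact: measurable_addrV.
    by apply/funext => z; rewrite addrC.
  apply: emeasurable_funM; first exact: measurableT_comp mw madd.
  exact: measurableT_comp mf (@measurable_snd _ _ _ _).
have : \int[vol]_y `|f y * \int[vol]_b (w (b + y)%R * f b)| = 0.
  transitivity (\int[vol]_y (f y * \int[vol]_b (w (b + y)%R * f b))).
    apply: eq_integral => y _; rewrite gee0_abs// mule_ge0// integral_ge0// => b _.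
    exact: mule_ge0.
  rewrite -integral_mul_convolution//; apply: integral0_eq => x _.
  rewrite -/h /w indicE; case: (boolP (x \in _)) => [/set_mem/= ->|_]; first by rewrite mule0.
  by rewrite mul0e.
move=> /ae_eq_integral_abs -/(_ measurableT mG).
apply: filterS => a /(_ Logic.I) /= fG fa.
have G0 : \int[vol]_b `|w (b + a)%R * f b| = 0.
  transitivity (\int[vol]_b (w (b + a)%R * f b)).
    by apply: eq_integral => b _; rewrite gee0_abs// mule_ge0.
  by move/eqP: fG; rewrite mule_eq0 gt_eqF//= => /eqP.
apply/negligibleP.
  apply: measurableI; first exact: measurable_pos_set.
  rewrite -[X in measurable X]setTI; exact: (measurable_translation a measurableT mB).
move/ae_eq_integral_abs : G0 => /(_ measurableT (mwf a)).
apply: negligibleS => b /= [fb hb] /(_ Logic.I) /eqP.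
by rewrite /w indicE mem_set//= mul1e gt_eqF.
Qed.

(** Let A be the support of f, an even set. Choose a in A, generic together
    with -a, so far out in the first coordinate that at most a quarter of the
    volume of A lies beyond it. The part of A + a in x_1 >= 0 and the part of
    A - a in x_1 < 0 are disjoint, each keeps at least 3/4 of the volume of A,
    and both lie in the support of f * f up to null sets. *)
Lemma support_convolution_growth (f : V -> \bar R) : kernel f ->
  (3 / 2)%:E * vol [set x | 0 < f x] <= vol [set x | 0 < convolution f f x].
Proof.
move=> kf; have [mh h0 _ _ _ _] := kernel_convolution kf.
have [mf f0 fN fgt _ _] := kf.
set A := [set x | 0 < f x]; set A' := [set x | 0 < convolution f f x].
have mA : measurable A by exact: measurable_pos_set.
have mA' : measurable A' by exact: measurable_pos_set.
have A0 : 0 < vol A by exact: kernel_support_gt0.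
have [N [mN N0 goodN]] := ae_support_translate kf.
have grow a D : ~ N a -> 0 < f a -> measurable D ->
    vol (A `&` [set b | D (b + a)%R]) <= vol (A' `&` D).
  move=> Na fa mD.
  have := goodN a; move/contra_not => /(_ Na)/contrapT/(_ fa); rewrite -/A => E0.
  have mD' : measurable [set b | D (b + a)%R].
    rewrite -[X in measurable X]setTI; exact: (measurable_translation a measurableT mD).
  have mpre : measurable ((fun y => y - - a)%R @^-1` (A' `&` D)).
    rewrite -[X in measurable X]setTI; apply: (measurable_translation (- - a)) => //.
    exact: measurableI.
  have mE : measurable (A `&` [set b | convolution f f (b + a)%R = 0]).
    apply: measurableI => //.
    rewrite -[X in measurable X]setTI.
    have mha := measurableT_comp mh (measurable_translation a).
    exact: (mha measurableT [set 0]).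
  rewrite -[leRHS](lebesgue_rV_translation (- a)); last exact: measurableI.
  apply: (@le_trans _ _ (vol (((fun y => y - - a)%R @^-1` (A' `&` D)) `|`
      (A `&` [set b | convolution f f (b + a)%R = 0])))).
    apply: le_mu_ext => b /= [Ab Db]; rewrite opprK.
    have [hb|hb] := eqVneq (convolution f f (b + a)%R) 0; first by right.
    by left; split => //; rewrite /A'/= lt0e hb h0.
  by apply: le_trans; [exact: measureU2|rewrite /= E0 adde0].
have [Ay|Afin] := eqVneq (vol A) +oo.
  have [a [fa Na]] : exists a, A a /\ ~ N a.
    apply: contrapT => noa; have : vol A <= vol N.
      apply: le_mu_ext => x Ax; apply: contrapT => Nx; apply: noa; by exists x.
    by rewrite N0 leNgt A0.
  apply: le_trans (leey _) _; rewrite -[leLHS]Ay.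
  apply: (@le_trans _ _ (vol (A' `&` setT))); last by rewrite setIT.
  apply: le_trans (grow a setT Na fa measurableT).
  by apply: le_mu_ext => b Ab; split.
have {}Afin : vol A < +oo by rewrite ltey.
have mH := measurable_halfspace.
have [r /andP[vgt vlt]] : exists r, 0 < vol (A `&` halfspace r) < vol A * (4^-1)%:E.
  have [|||||r] := @small_halfspace_integral _ _ (EFin \o \1_A) (vol A * (4^-1)%:E).
  - by apply/measurable_EFinP; exact: measurable_indic.
  - by move=> x; rewrite lee_fin.
  - by rewrite integral_indic// setIT.
  - by rewrite integral_indic// setIT.
  - by rewrite mule_gt0.
  by move=> h; exists r; move: h; rewrite integral_indic; [|exact: mH|exact: mA].
have [a [Aa ra Na Na']] : exists a, [/\ A a, halfspace r a, ~ N a & ~ N (- a)%R].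
  apply: contrapT => noa; move: vgt; rewrite ltNge => /negP; apply.
  have mN' : measurable ((fun y => 0 - y)%R @^-1` N).
    by rewrite -[X in measurable X]setTI; exact: measurable_reflection.
  apply: (@le_trans _ _ (vol (N `|` ((fun y => 0 - y)%R @^-1` N)))).
    apply: le_mu_ext => x [Ax rx]; apply: contrapT => /not_orP[Nx Nx']; apply: noa.
    by exists x; split => //; move: Nx'; rewrite /= sub0r.
  apply: le_trans; first exact: measureU2.
  have N'0 : vol ((fun y => 0 - y)%R @^-1` N) = 0 by rewrite lebesgue_rV_reflection.
  by rewrite /= N0 N'0 adde0.
set v := vol (A `&` halfspace r) in vgt vlt.
pose X (x : V) : R := x ord0 ord0.
have mX : measurable_fun [set: V] X by exact: measurable_coord.
have mlt c : measurable [set x | (X x < c)%R].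
  rewrite -[X in measurable X]setTI (_ : [set _ | _] = X @^-1` `]-oo, c[%classic).
    exact: mX.
  by apply/seteqP; split => x /=; rewrite in_itv.
have mge c : measurable [set x | (c <= X x)%R].
  rewrite -[X in measurable X]setTI (_ : [set _ | _] = X @^-1` `[c, +oo[%classic).
    exact: mX.
  by apply/seteqP; split => x /=; rewrite in_itv/= andbT.
have geC c : ~` [set x | (c <= X x)%R] = [set x | (X x < c)%R].
  by apply/seteqP; split => x /=; rewrite ltNge => /negP.
pose p := vol (A `&` [set b | (- X a <= X b)%R]).
pose q := vol (A `&` [set b | (X b < X a)%R]).
have split_at c (B : set V) : measurable B -> vol B =
    vol (B `&` [set b | (c <= X b)%R]) + vol (B `&` [set b | (X b < c)%R]).
  by move=> mB; rewrite -geC -setDE addeC (measureDI _ mB (mge c)).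
have pq : p + q <= vol A'.
  rewrite (split_at 0%R A')// leeD//.
    apply: le_trans (grow a _ Na Aa (mge 0%R)); apply: le_mu_ext => b [Ab /= hb].
    by split => //=; rewrite /X mxE -lerBlDr sub0r.
  have AaN : 0 < f (- a)%R by rewrite fN.
  apply: le_trans (grow (- a)%R _ Na' AaN (mlt 0%R)); apply: le_mu_ext => b [Ab /= hb].
  by split => //=; rewrite /X !mxE subr_lt0.
have Ap : vol A <= p + v.
  rewrite (split_at (- X a)%R A)// leeD//.
  rewrite -(lebesgue_rV_reflection 0); last exact: measurableI.
  apply: le_mu_ext => b /= [Ab]; rewrite /X !mxE add0r ltrN2 => ab; split.
    by move: Ab; rewrite /A/= sub0r fN.
  exact: lt_trans ab.
have Aq : vol A <= q + v.
  rewrite (split_at (X a)%R A)// addeC leeD//.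
  by apply: le_mu_ext => b /= [Ab ab]; split => //; exact: lt_le_trans ab.
apply: le_trans pq.
have fin (B : set V) : B `<=` A -> vol B \is a fin_num.
  by move=> BA; rewrite ge0_fin_numE// (le_lt_trans (le_mu_ext _ BA)).
have pf : p \is a fin_num by apply: fin => x [].
have qf : q \is a fin_num by apply: fin => x [].
have vf : v \is a fin_num by apply: fin => x [].
have Af : vol A \is a fin_num by apply: fin.
move: Ap Aq vlt; rewrite -(fineK pf) -(fineK qf) -(fineK vf) -(fineK Af).
by rewrite -!EFinD -!EFinM !lee_fin lte_fin => h1 h2 h3; lra.
Qed.
End support_growth.

(** * The sharp functional *)

Section sharp.
Context (R : realType) (d : nat).
Local Notation V := 'rV[R]_d.
Local Notation vol := (@lebesgue_rV R d).
Implicit Types (f : V -> \bar R) (t s : R).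

Lemma volume_radiusK t : (0 < d)%N -> (0 <= t)%R ->
  vol (eball 1) * (volume_radius d t ^+ d)%:E = t%:E.
Proof.
move=> d0 t0; rewrite /volume_radius.
have Bf : vol (eball 1) \is a fin_num by rewrite ge0_fin_numE// eball_bounded.
have B0 : (0 < fine (vol (eball 1)))%R.
  by rewrite fine_gt0// eball_gt0 eball_bounded.
have tB : (0 <= t / fine (vol (eball 1)))%R by rewrite divr_ge0// ltW.
rewrite -powR_mulrn ?powR_ge0// -powRrM mulVf ?pnatr_eq0 -?lt0n// powRr1//.
by rewrite -[X in X * _](fineK Bf) -EFinM mulrC divfK// gt_eqF.
Qed.

Lemma lt_rearrangement f t s : (0 < d)%N -> (0 <= t)%R -> (0 < s)%R ->
  s%:E < rearrangement f (volume_radius d t) ->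
  t%:E < vol [set x | s%:E < f x].
Proof.
move=> d0 t0 s0; rewrite ltNge => /negP sc; rewrite ltNge; apply/negP => ft.
apply: sc; apply: ereal_inf_lbound; exists s => //=; split => //.
by rewrite volume_radiusK.
Qed.

Lemma le_rearrangement f t s : (0 < d)%N -> (0 <= t)%R ->
  t%:E < vol [set x | s%:E < f x] ->
  s%:E <= rearrangement f (volume_radius d t).
Proof.
move=> d0 t0 ts; apply: le_ereal_inf_tmp => _ [s' /= [s'0 s't] <-].
rewrite volume_radiusK// in s't; rewrite lee_fin leNgt; apply/negP => ss'.
have : t%:E < t%:E by apply: lt_le_trans ts (le_trans _ s't); apply: le_mu_ext => x /=;
  apply: le_lt_trans; rewrite lee_fin ltW.
by rewrite ltxx.
Qed.

Lemma sharp_le_integral f t : measurable_fun [set: V] f -> (forall x, 0 <= f x) ->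
  sharp f t <= \int[vol]_x f x.
Proof.
move=> mf f0; apply: ge0_subset_integral => //.
by rewrite -[X in measurable X]setTI; exact: emeasurable_fun_infty_o.
Qed.

(** The bathtub principle: the integral over the complement of a set of volume t
    is least when the set collects the largest values of f. For s below f^* the
    part of A where f <= s has at most the volume of the part of the complement
    of A where f > s, because {f > s} has volume more than t; hence the integral
    over the complement of A is at least the one over {f <= s}. Letting s
    increase to f^* gives the claim. *)
Lemma sharp_le_integral_setC f t (A : set V) : (0 < d)%N -> (0 <= t)%R ->
  kernel f -> measurable A -> vol A = t%:E ->
  sharp f t <= \int[vol]_(x in ~` A) f x.
Proof.
move=> d0 t0 [mf f0 _ _ _ [M fM]] mA At; rewrite /sharp.
set c := rearrangement f _.
pose m : {measure set V -> \bar R} := density_measure vol mf f0.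
have mle (e : \bar R) : measurable [set x | f x <= e].
  by rewrite -[X in measurable X]setTI; exact: emeasurable_fun_infty_c.
have mgt (e : \bar R) : measurable [set x | e < f x].
  by rewrite -[X in measurable X]setTI; exact: emeasurable_fun_o_infty.
have leC (e : \bar R) : ~` [set x | f x <= e] = [set x | e < f x].
  by apply/seteqP; split => x /=; rewrite ltNge => /negP.
(* The exchange argument at a level s < c. *)
have below s : (0 < s)%R -> s%:E < c -> m [set x | f x <= s%:E] <= m (~` A).
  move=> s0 sc; have ts := lt_rearrangement d0 t0 s0 sc.
  set L := [set x | f x <= s%:E]; have mL : measurable L by exact: mle.
  have mLC : measurable (~` L) by exact: measurableC.
  have mAC : measurable (~` A) by exact: measurableC.
  have volLA : vol (L `&` A) <= vol (~` A `&` ~` L).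
    have split_vol (B C : set V) : measurable B -> measurable C ->
        vol B = vol (B `&` ~` C) + vol (B `&` C).
      by move=> mB mC; rewrite (measureDI _ mB mC) setDE.
    rewrite (setIC L) (setIC (~` A)).
    have : vol (A `&` ~` L) + vol (A `&` L) <= vol (A `&` ~` L) + vol (~` L `&` ~` A).
      by rewrite -split_vol// At (setIC A) addeC -split_vol// leC ltW.
    rewrite leeD2lE// ge0_fin_numE//.
    by apply: (@le_lt_trans _ _ (vol A)); [apply: le_mu_ext => x []|rewrite At ltry].
  have mI : m (L `&` A) <= s%:E * vol (L `&` A).
    rewrite /m/= /density_measure /density -integral_cst; last exact: measurableI.
    apply: ge0_le_integral => //; first exact: measurableI.
    - exact: measurable_funTS.
    - by move=> x [].
  have mI' : s%:E * vol (~` A `&` ~` L) <= m (~` A `&` ~` L).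
    rewrite /m/= /density_measure /density -integral_cst; last exact: measurableI.
    apply: ge0_le_integral => //; first exact: measurableI.
    - by move=> x _; rewrite lee_fin ltW.
    - exact: measurable_funTS.
    - by move=> x [_ /negP]; rewrite -ltNge => /ltW.
  rewrite (measureDI m mL mA) (measureDI m mAC mL) !setDE [leRHS]addeC (setIC (~` A) L).
  apply: leeD2l.
  by apply: le_trans mI _; apply: le_trans mI'; rewrite lee_wpmul2l// lee_fin ltW.
change (m [set h | f h < c] <= m (~` A)).
have [c0|c0] := leP c 0.
  rewrite (_ : [set h | _] = set0) ?measure0//.
  by rewrite -subset0 => x /=; rewrite ltNge (le_trans c0).
have cM : c <= (`|M| + 1)%:E.
  apply: ereal_inf_lbound; exists (`|M| + 1)%R => //=; split.
    by rewrite ltr_wpDl.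
  rewrite (_ : [set x | _] = set0) ?measure0 ?mule_ge0// ?lee_fin ?exprn_ge0 ?powR_ge0//.
  rewrite -subset0 => x /=; rewrite ltNge (le_trans (fM x))// lee_fin.
  by rewrite (le_trans (ler_norm _))// lerDl.
have cf : c \is a fin_num by rewrite ge0_fin_numE ?ltW// (le_lt_trans cM) ?ltry.
pose c' := fine c; have cE : c = c'%:E by rewrite fineK.
have c'0 : (0 < c')%R by rewrite -lte_fin -cE.
(* Positive levels increasing to c. *)
pose s_ n : R := (c' * (1 - n.+2%:R^-1))%R.
pose F n := [set x | f x <= (s_ n)%:E].
have mF n : measurable (F n) by exact: mle.
have -> : [set h | f h < c] = \bigcup_n F n.
  apply/seteqP; split => [x /= fc|x [n _] /= fs]; last first.
    by apply: le_lt_trans fs _; rewrite cE lte_fin /s_ gtr_pMr// ltrBlDr ltrDl.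
  have ff : f x \is a fin_num by rewrite ge0_fin_numE// (lt_le_trans fc)// leey.
  move: fc; rewrite cE -(fineK ff) lte_fin -subr_gt0 => fc.
  have [n nx] := @exists_natSinv_lt R ((c' - fine (f x)) / c') ltac:(by rewrite divr_gt0).
  exists n => //; rewrite /F/= -(fineK ff) lee_fin /s_ mulrBr mulr1 lerBrDl -lerBrDr.
  rewrite mulrC -ler_pdivlMr// (le_trans _ (ltW nx))//.
  by rewrite lef_pV2 ?posrE// ler_nat.
have cvgF : (m \o F) n @[n --> \oo] --> m (\bigcup_n F n).
  apply: nondecreasing_cvg_mu => //; first exact: bigcupT_measurable.
  move=> i j ij; apply/subsetPset => x /= /le_trans; apply.
  rewrite lee_fin /s_ ler_wpM2l ?(ltW c'0)// lerD2l lerN2.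
  by rewrite lef_pV2 ?posrE// ler_nat !ltnS.
rewrite -(cvg_lim _ cvgF)//; apply: lime_le; first by apply/cvg_ex; eexists; exact: cvgF.
apply: nearW => n; apply: below.
  by rewrite mulr_gt0// subr_gt0 invf_lt1// ltr1n.
by rewrite cE lte_fin gtr_pMr// ltrBlDr ltrDl.
Qed.

End sharp.

(** A support of volume more than t forces a level s > 0 with {h > s} of volume
    more than t, hence h^* >= s > 0; and h takes positive values below s on a
    set of positive measure. *)
Lemma sharp_convolution_gt0 (R : realType) n (f : 'rV[R]_n.+1 -> \bar R) (t : R) :
  (0 <= t)%R -> kernel f ->
  t%:E < lebesgue_rV [set x | 0 < convolution f f x] ->
  0 < sharp (convolution f f) t.
Proof.
move=> t0 kf tf.
have [mh h0 _ _ _ _] := kernel_convolution kf.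
set h := convolution f f in mh h0 tf *.
have [k tk] : exists k : nat, t%:E < lebesgue_rV [set x | (k.+1%:R^-1)%:E < h x].
  apply: contrapT => /forallNP noK; move: tf; rewrite ltNge => /negP; apply.
  pose F k := [set x | (k.+1%:R^-1)%:E < h x].
  have mF k : measurable (F k).
    by rewrite -[X in measurable X]setTI; exact: emeasurable_fun_o_infty.
  have -> : [set x | 0 < h x] = \bigcup_k F k.
    apply/seteqP; split => [x /= hx|x [k _] /=]; last by apply: le_lt_trans.
    case hxE : (h x) hx => [r| |]//.
      rewrite lte_fin => /exists_natSinv_lt[k kr]; exists k => //.
      by rewrite /F/= hxE lte_fin.
    by move=> _; exists 0%N => //=; rewrite /F/= hxE ltry.
  have cvgF : (@lebesgue_rV R _ \o F) k @[k --> \oo] --> lebesgue_rV (\bigcup_k F k).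
    apply: nondecreasing_cvg_mu => //; first exact: bigcupT_measurable.
    move=> i j ij; apply/subsetPset => x /=; apply: le_lt_trans.
    by rewrite lee_fin lef_pV2 ?posrE// ler_nat ltnS.
  rewrite -(cvg_lim _ cvgF)//; apply: lime_le; first by apply/cvg_ex; eexists; exact: cvgF.
  by apply: nearW => k; rewrite leNgt; exact/negP/noK.
have s0 : (0 < k.+1%:R^-1 :> R)%R by rewrite invr_gt0.
apply: lt_le_trans (integral_sublevel_convolution_gt0 kf s0) _.
have mlt (e : \bar R) : measurable [set x | h x < e].
  by rewrite -[X in measurable X]setTI; exact: emeasurable_fun_infty_o.
apply: ge0_subset_integral => //; first exact: measurable_funTS.
move=> x /= hx; apply: lt_le_trans hx _; exact: le_rearrangement.
Qed.

(** * Energies *)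

(** The integral of (f * f) Phi is the double integral of
    f(b) f(k) Phi(b + k), which splits into two equal terms. *)
Lemma integral_convolution_quasi_subadditive (R : realType) (d : nat) (K : R)
    (f Phi : 'rV[R]_d -> \bar R) : (0 <= K)%R ->
  measurable_fun setT f -> (forall x, 0 <= f x) ->
  measurable_fun setT Phi -> (forall x, 0 <= Phi x) ->
  (forall b k, Phi (b + k)%R <= K%:E * (Phi b + Phi k)) ->
  \int[@lebesgue_rV R d]_h (convolution f f h * Phi h) <=
  (2 * K)%:E * \int[@lebesgue_rV R d]_h f h * \int[@lebesgue_rV R d]_h (f h * Phi h).
Proof.
move=> K0 mf f0 mP P0 PD; pose vol := @lebesgue_rV R d.
have K0' : 0 <= K%:E by [].
pose I := \int[vol]_x f x; pose E := \int[vol]_h (f h * Phi h).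
have mPf : measurable_fun [set: 'rV[R]_d] (fun x => f x * Phi x) by exact: emeasurable_funM.
have mfP k : measurable_fun [set: 'rV[R]_d] (fun b => Phi k * f b) by exact: emeasurable_funM.
have Pf0 x : 0 <= f x * Phi x by exact: mule_ge0.
have fP0 k x : 0 <= Phi k * f x by exact: mule_ge0.
have I0 : 0 <= I by exact: integral_ge0.
have E0 : 0 <= E by exact: integral_ge0.
under eq_integral do rewrite muleC.
rewrite integral_mul_convolution//.
have inner k : \int[vol]_b (Phi (b + k)%R * f b) <= K%:E * (E + Phi k * I).
  rewrite /E /I -ge0_integralZl// -ge0_integralD// -ge0_integralZl//; last 2 first.
  - exact: emeasurable_funD.
  - by move=> b _; rewrite adde_ge0.
  apply: ge0_le_integral_nonmeasurable => b; first exact: mule_ge0.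
  by rewrite [f b * _]muleC -ge0_muleDl// muleA lee_wpmul2r.
have mEf : measurable_fun [set: 'rV[R]_d] (fun k => E * f k) by exact: emeasurable_funM.
have mIP : measurable_fun [set: 'rV[R]_d] (fun k => I * (f k * Phi k)) by exact: emeasurable_funM.
have Ef0 k : 0 <= E * f k by exact: mule_ge0.
have IP0 k : 0 <= I * (f k * Phi k) by exact: mule_ge0.
apply: (@le_trans _ _ (\int[vol]_k (K%:E * (E * f k + I * (f k * Phi k))))).
  apply: ge0_le_integral_nonmeasurable => k.
    by rewrite mule_ge0// integral_ge0// => b _; exact: mule_ge0.
  rewrite [leRHS](_ : _ = f k * (K%:E * (E + Phi k * I))); first by rewrite lee_wpmul2l.
  rewrite [RHS]muleCA; congr (K%:E * _).
  by rewrite ge0_muleDr ?mule_ge0// [f k * E]muleC [f k * (_ * I)]muleA [I * _]muleC.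
rewrite ge0_integralZl//; last 2 first.
- exact: emeasurable_funD.
- by move=> k _; rewrite adde_ge0.
rewrite ge0_integralD// !ge0_integralZl// -/vol -/I -/E [E * I]muleC.
by rewrite -mule2n -muleA [(2 * K)%R]mulrC EFinM -muleA mule_natl.
Qed.

Section energy_kernel.
Context (R : realType) (d : nat) (p : R).
Hypothesis p1 : (1 <= p)%R.
Local Notation V := 'rV[R]_d.
Local Notation vol := (@lebesgue_rV R d).
Implicit Types (u : V -> R) (f : V -> \bar R).

Let p_ge0 : (0 <= p)%R. Proof. exact: le_trans p1. Qed.

(** Convexity of the power p at the midpoint of 2a and 2b. *)
Lemma powR_normD_le (a b : R) :
  (`|a + b| `^ p <= 2^-1 * 2 `^ p * (`|a| `^ p + `|b| `^ p))%R.
Proof.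
have half : (2^-1 = 1 - 2^-1 :> R)%R by lra.
apply: (@le_trans _ _ ((2^-1 * (2 * `|a|) + 2^-1 * (2 * `|b|)) `^ p)%R).
  rewrite ge0_ler_powR ?nnegrE//.
  by rewrite !mulrA mulVf ?pnatr_eq0// !mul1r ler_normD.
have : ((2^-1 * (2 * `|a|) + 2^-1 * (2 * `|b|)) `^ p <=
    2^-1 * (2 * `|a|) `^ p + 2^-1 * (2 * `|b|) `^ p)%R.
  rewrite {2 4}half.
  by apply: (convex_powR p1 (Itv01 _ _)) => //=;
    rewrite ?inE/= ?in_itv/= ?andbT ?mulr_ge0// ?invr_ge0// invf_le1 ?ler1n.
move=> /le_trans; apply; rewrite !powRM// mulrDr !mulrA//.
Qed.

Definition increment_energy u (h : V) : \bar R :=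
  \int[vol]_x (`|u x - u (x - h)%R| `^ p)%:E.

(** The double integral of |u(x) - u(y)|^p f(x - y), after the substitution
    h = x - y. In this form the increments of u enter only through a function
    of h. *)
Definition kernel_energy f u : \bar R :=
  \int[vol]_h (f h * increment_energy u h).

Lemma increment_energy_ge0 u h : 0 <= increment_energy u h.
Proof. by apply: integral_ge0 => x _; rewrite lee_fin powR_ge0. Qed.

Lemma measurable_increment u : measurable_fun [set: V] u ->
  measurable_fun [set: V * V]
    (fun z => (`|u z.2 - u (z.2 - z.1)%R| `^ p)%:E).
Proof.
move=> mu; apply/measurable_EFinP.
apply: (measurableT_comp (measurable_powR _)).
apply: measurableT_comp => //; apply: measurable_funB.
  exact: measurableT_comp mu (@measurable_snd _ _ _ _).
have mswap : measurable_fun [set: V * V] (fun z : V * V => (z.2 - z.1)%R).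
  exact: (measurableT_comp (@measurable_subrV R d) (@measurable_swap _ _ _ _)).
exact: measurableT_comp mu mswap.
Qed.

Lemma measurable_increment_energy u : measurable_fun [set: V] u ->
  measurable_fun [set: V] (increment_energy u).
Proof.
move=> mu.
apply: (@measurable_fun_fubini_tonelli_F _ _ V V R vol _ (measurable_increment mu)) => z.
by rewrite lee_fin powR_ge0.
Qed.

Lemma increment_energyD u b k : measurable_fun [set: V] u ->
  increment_energy u (b + k)%R <=
  (2^-1 * 2 `^ p)%:E * (increment_energy u b + increment_energy u k).
Proof.
move=> mu; pose g h (x : V) : \bar R := (`|u x - u (x - h)%R| `^ p)%:E.
have mg h : measurable_fun [set: V] (g h).
  exact: (measurableT_comp (measurable_increment mu) (@measurable_pair1 _ _ _ _ h)).
have g0 h x : 0 <= g h x by rewrite lee_fin powR_ge0.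
have K0 : (0 <= 2^-1 * 2 `^ p :> R)%R by rewrite mulr_ge0 ?powR_ge0.
have gD x : g (b + k)%R x <= (2^-1 * 2 `^ p)%:E * (g b x + g k (x - b)%R).
  rewrite /g -EFinD -EFinM lee_fin.
  rewrite (_ : u x - u (x - (b + k)) = (u x - u (x - b)) + (u (x - b) - u (x - b - k)))%R.
    exact: powR_normD_le.
  by rewrite addrA subrK opprD addrA.
rewrite -[increment_energy u _]/(\int[vol]_x g _ x) -[increment_energy u b]/(\int[vol]_x g _ x).
rewrite -[increment_energy u k]/(\int[vol]_x g _ x).
move: (2^-1 * 2 `^ p)%R K0 gD => K K0 gD; clearbody g.
have mgb : measurable_fun [set: V] (fun x => g k (x - b)%R).
  exact: measurableT_comp (mg k) (measurable_translation (- b)%R).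
have mgD : measurable_fun [set: V] (fun x => g b x + g k (x - b)%R).
  exact: emeasurable_funD.
rewrite -[X in _ * (_ + X)](ge0_integral_translation b (mg k) (g0 k)).
rewrite -ge0_integralD// -ge0_integralZl//; last by move=> x _; rewrite adde_ge0.
apply: ge0_le_integral => //; exact: emeasurable_funM.
Qed.

Lemma kernel_energy_ge0 f u : (forall x, 0 <= f x) -> 0 <= kernel_energy f u.
Proof.
by move=> f0; apply: integral_ge0 => x _; rewrite mule_ge0// increment_energy_ge0.
Qed.

Lemma kernel_energy_convolution f u :
  measurable_fun [set: V] u -> measurable_fun [set: V] f -> (forall x, 0 <= f x) ->
  kernel_energy (convolution f f) u <=
  (2 `^ p)%:E * \int[vol]_x f x * kernel_energy f u.
Proof.
move=> mu mf f0.
have K0 : (0 <= 2^-1 * 2 `^ p :> R)%R by rewrite mulr_ge0 ?powR_ge0.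
have := integral_convolution_quasi_subadditive K0 mf f0
  (measurable_increment_energy mu) (increment_energy_ge0 u)
  (fun b k => increment_energyD b k mu).
by rewrite mulrA mulfV ?pnatr_eq0// mul1r.
Qed.

Lemma le_kernel_energy f g u : (forall x, 0 <= f x) -> (forall x, f x <= g x) ->
  kernel_energy f u <= kernel_energy g u.
Proof.
move=> f0 fg; apply: ge0_le_integral_nonmeasurable => x.
  by rewrite mule_ge0// increment_energy_ge0.
by rewrite lee_wpmul2r// increment_energy_ge0.
Qed.

Lemma measurable_energy_integrand f u :
  measurable_fun [set: V] u -> measurable_fun [set: V] f ->
  measurable_fun [set: V * V]
    (fun z => (`|u z.1 - u z.2| `^ p)%:E * f (z.1 - z.2)%R).
Proof.
move=> mu mf; apply: emeasurable_funM.
  apply/measurable_EFinP; apply: (measurableT_comp (measurable_powR _)).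
  apply: measurableT_comp => //; apply: measurable_funB.
    exact: measurableT_comp mu (@measurable_fst _ _ _ _).
  exact: measurableT_comp mu (@measurable_snd _ _ _ _).
exact: measurableT_comp mf (@measurable_subrV R d).
Qed.

Lemma kernel_energyE f u :
  measurable_fun [set: V] u -> measurable_fun [set: V] f -> (forall x, 0 <= f x) ->
  \int[vol]_x \int[vol]_y ((`|u x - u y| `^ p)%:E * f (x - y)%R) =
  kernel_energy f u.
Proof.
move=> mu mf f0.
have mF := measurable_energy_integrand mu mf.
transitivity (\int[vol]_x \int[vol]_h ((`|u x - u (x - h)%R| `^ p)%:E * f h)).
  apply: eq_integral => x _.
  rewrite -(ge0_integral_reflection x (measurableT_comp mF (@measurable_pair1 _ _ _ _ x))).
    by apply: eq_integral => h _ /=; rewrite subKr.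
  by move=> y /=; rewrite mule_ge0// lee_fin powR_ge0.
have mi := measurable_increment mu.
rewrite (@fubini_tonelli _ _ V V R vol vol
  (fun z : V * V => (`|u z.1 - u (z.1 - z.2)%R| `^ p)%:E * f z.2)); last 2 first.
- apply: emeasurable_funM; last exact: measurableT_comp mf (@measurable_snd _ _ _ _).
  exact: (measurableT_comp mi (@measurable_swap _ _ _ _)).
- by move=> z; rewrite mule_ge0// lee_fin powR_ge0.
apply: eq_integral => h _ /=; rewrite muleC -ge0_integralZr//.
  exact: measurableT_comp mi (@measurable_pair1 _ _ _ _ h).
Qed.

(** Keep only the pairs (x, y) with y outside A, where u(y) = 0. For each x the
    weight f(x - y) is then integrated over the complement of x - A, a set of
    the same volume as A, and the bathtub principle applies. *)
Lemma sharp_le_kernel_energy f u (A : set V) t :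
  (0 < d)%N -> (0 <= t)%R -> kernel f -> measurable A -> vol A = t%:E ->
  measurable_fun [set: V] u -> (forall x, ~ A x -> u x = 0%R) ->
  \int[vol]_x (`|u x| `^ p)%:E * sharp f t <= kernel_energy f u.
Proof.
move=> d0 t0 kf mA At mu uA; have [mf f0 _ _ _ _] := kf.
have s0 : 0 <= sharp f t by exact: integral_ge0.
have mup : measurable_fun [set: V] (fun x => (`|u x| `^ p)%:E).
  apply/measurable_EFinP; apply: (measurableT_comp (measurable_powR _)).
  exact: measurableT_comp.
rewrite -kernel_energyE// -ge0_integralZr//.
apply: ge0_le_integral_nonmeasurable => x.
  by rewrite mule_ge0// lee_fin powR_ge0.
have mAC : measurable (~` A) by exact: measurableC.
have mpre : measurable ((fun y => x - y)%R @^-1` A).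
  by rewrite -[X in measurable X]setTI; exact: measurable_reflection.
have mfx : measurable_fun [set: V] (fun y => f (x - y)%R).
  exact: measurableT_comp mf (measurable_reflection x).
pose fA := (fun y => f (x - y)%R) \_ (~` A).
have mfA : measurable_fun [set: V] fA.
  by apply/(measurable_restrictT _ _).1 => //; exact: measurable_funTS.
have fA0 y : 0 <= fA y by rewrite /fA patchE; case: ifP.
have ux0 : 0 <= (`|u x| `^ p)%:E by rewrite lee_fin powR_ge0.
apply: (@le_trans _ _ (\int[vol]_y ((`|u x| `^ p)%:E * fA y))).
  rewrite ge0_integralZl//.
  rewrite lee_wpmul2l//.
  apply: le_trans (sharp_le_integral_setC d0 t0 kf mpre _) _.
    by rewrite lebesgue_rV_reflection.
  pose fB := f \_ (~` ((fun y => x - y)%R @^-1` A)).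
  have mfB : measurable_fun [set: V] fB.
    have mBC := measurableC mpre.
    by apply/(measurable_restrictT _ _).1 => //; exact: measurable_funTS.
  have fB0 y : 0 <= fB y by rewrite /fB patchE; case: ifP.
  rewrite [leLHS](_ : _ = \int[vol]_y fB (x - y)%R); last first.
    by rewrite integral_mkcond (ge0_integral_reflection x mfB fB0).
  apply: ge0_le_integral_nonmeasurable => // y.
  rewrite /fA /fB !patchE; case: ifPn => [/set_mem/=|//]; last by case: ifP.
  by rewrite subKr => Ay; rewrite ifT//; exact/mem_set.
apply: ge0_le_integral_nonmeasurable => y; first exact: mule_ge0.
rewrite /fA patchE; case: ifPn => [/set_mem/= Ay|_]; first by rewrite (uA y Ay) subr0.
by rewrite mule0 mule_ge0// lee_fin powR_ge0.
Qed.

End energy_kernel.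

(** * The iterated kernels *)

Lemma expeD (R : realDomainType) (x : \bar R) m n : x ^+ (m + n) = x ^+ m * x ^+ n.
Proof.
elim: m => [|m IH]; first by rewrite add0n expe0 mul1e.
by rewrite addSn !expeS IH muleA.
Qed.

Section qker_kernel.
Context (R : realType) (d : nat) (nu : 'rV[R]_d -> R).
Local Notation V := 'rV[R]_d.
Local Notation vol := (@lebesgue_rV R d).
Hypotheses (mnu : measurable_fun [set: V] nu) (nu0 : forall x, (0 <= nu x)%R).
Hypothesis nuN : forall x, nu (- x)%R = nu x.
Hypothesis nu_int : \int[vol]_(h in ~` eball 1) (nu h)%:E < +oo.
Hypothesis nu_gt0 : 0 < vol [set x | (0 < nu x)%R].

Lemma kernel_truncation : kernel (qker nu 0).
Proof.
have q0 x : 0 <= qker nu 0 x by rewrite /qker/= lee_fin le_min ler01 nu0.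
have mq : measurable_fun [set: V] (qker nu 0).
  apply/measurable_EFinP; exact: measurable_minr.
split => //.
- by move=> x; rewrite /qker/= nuN.
- rewrite lt0e integral_ge0// andbT; apply/eqP => q_eq0.
  have : \int[vol]_x `|qker nu 0 x| = 0.
    by rewrite -q_eq0; apply: eq_integral => x _; rewrite gee0_abs.
  move=> /ae_eq_integral_abs -/(_ measurableT mq) [N [mN N0 qN]].
  move: nu_gt0; rewrite ltNge => /negP; apply; rewrite -N0; apply: le_mu_ext => x /= nux.
  apply: qN => /= /(_ Logic.I) /eqP; rewrite /qker/= eqe; apply/negP.
  by rewrite gt_eqF// lt_min ltr01 nux.
- have mB := measurable_eball (d := d) (1 : R); have mBC := measurableC mB.
  have m1 : measurable_fun [set: V] (fun x => (\1_(eball 1) x)%:E : \bar R).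
    by apply/measurable_EFinP; exact: measurable_indic.
  have m2 : measurable_fun [set: V] ((EFin \o nu) \_ (~` eball 1)).
    by apply/(measurable_restrictT _ _).1 => //; apply: measurable_funTS; exact/measurable_EFinP.
  have n2 x : 0 <= ((EFin \o nu) \_ (~` eball 1)) x.
    by rewrite patchE; case: ifP => //= _; rewrite lee_fin.
  apply: (@le_lt_trans _ _ (\int[vol]_x ((\1_(eball 1) x)%:E + ((EFin \o nu) \_ (~` eball 1)) x))).
    apply: ge0_le_integral_nonmeasurable => // x; rewrite patchE indicE.
    have [/set_mem xB|/negP xB] := boolP (x \in eball 1).
      rewrite /qker/= (le_trans (_ : _ <= 1))//; first by rewrite lee_fin ge_min lexx.
      by rewrite leeDl//; case: ifP => // _; rewrite lee_fin.
    rewrite ifT ?add0e; first by rewrite /qker/= lee_fin ge_min lexx orbT.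
    by apply/mem_set => /= xB'; exact/xB/mem_set.
  rewrite ge0_integralD// integral_indic// setIT -integral_mkcond.
  by rewrite lte_add_pinfty// eball_bounded.
- by exists 1%R => x; rewrite /qker/= lee_fin ge_min lexx.
Qed.

Lemma qkerS m : qker nu m.+1 = convolution (qker nu m) (qker nu m).
Proof. by []. Qed.

Lemma kernel_qker m : kernel (qker nu m).
Proof.
by elim: m => [|m IH]; [exact: kernel_truncation|rewrite qkerS; exact: kernel_convolution].
Qed.

Lemma integral_qker m :
  \int[vol]_x qker nu m x = (\int[vol]_x qker nu 0 x) ^+ (2 ^ m)%N.
Proof.
elim: m => [|m IH]; first by rewrite expn0.
have [mq q0 _ _ _ _] := kernel_qker m.
by rewrite qkerS integral_convolution// IH expnS mul2n -addnn expeD.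
Qed.

(** The exponent of the mass accumulates as 1 + 2 + ... + 2^(m-1) = 2^m - 1. *)
Lemma kernel_energy_qker p u m : (1 <= p)%R -> measurable_fun [set: V] u ->
  kernel_energy p (qker nu m) u <=
  (2 `^ (p * m%:R))%:E * (\int[vol]_x qker nu 0 x) ^+ (2 ^ m - 1)%N *
  kernel_energy p (EFin \o nu) u.
Proof.
move=> p1 mu; elim: m => [|m IH].
  rewrite mulr0 powRr0 expn0 subnn expe0 !mul1e.
  apply: le_kernel_energy => x; rewrite /qker/= lee_fin ?le_min ?ler01 ?nu0//.
  by rewrite ge_min lexx orbT.
have [mq q0 _ _ _ _] := kernel_qker m.
rewrite qkerS (le_trans (kernel_energy_convolution p1 mu mq q0))//.
have I0 : 0 <= \int[vol]_x qker nu 0 x.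
  by have [_ ? _ _ _ _] := kernel_qker 0; exact: integral_ge0.
apply: le_trans (lee_wpmul2l _ IH) _.
  by rewrite mule_ge0 ?lee_fin ?powR_ge0// integral_qker expe_ge0.
rewrite integral_qker.
have -> : (2 ^ m.+1 - 1 = 2 ^ m + (2 ^ m - 1))%N.
  by rewrite expnS mul2n -addnn addnBA// expn_gt0.
rewrite expeD -(@natr1 _ m) mulrDr mulr1 powRD ?pnatr_eq0 ?implybT// EFinM.
rewrite !muleA le_eqVlt; apply/orP; left; apply/eqP; congr (_ * _ * _).
by rewrite muleC muleA.
Qed.

End qker_kernel.

(** * Passing to Borel representatives *)

Section almost_everywhere_rV.
Context (R : realType) (d : nat).
Local Notation V := 'rV[R]_d.
Local Notation vol := (@lebesgue_rV R d).
Implicit Types (P : V -> Prop) (f g : V -> \bar R).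

Lemma ae_reflection (x : V) P : {ae vol, forall y, P y} -> {ae vol, forall y, P (x - y)%R}.
Proof.
move=> [N [mN N0 PN]]; exists ((fun y => x - y)%R @^-1` N); split.
- by rewrite -[X in measurable X]setTI; exact: measurable_reflection.
- by rewrite lebesgue_rV_reflection.
- by move=> y /= Py; exact: PN.
Qed.

Lemma ae_prod_fst P : {ae vol, forall y, P y} -> {ae vol \x vol, forall z, P z.1}.
Proof.
move=> [N [mN N0 PN]]; exists (N `*` setT); split.
- exact: measurableX.
- by rewrite product_measure1E//= N0 mul0e.
- by move=> z /= Pz; split => //; exact: PN.
Qed.

Lemma ae_prod_snd P : {ae vol, forall y, P y} -> {ae vol \x vol, forall z, P z.2}.
Proof.
move=> [N [mN N0 PN]]; exists (setT `*` N); split.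
- exact: measurableX.
- by rewrite product_measure1E//= N0 mule0.
- by move=> z /= Pz; split => //; exact: PN.
Qed.

Lemma ae_prod_sub P :
  {ae vol, forall y, P y} -> {ae vol \x vol, forall z, P (z.1 - z.2)%R}.
Proof.
move=> [N [mN N0 PN]]; exists ((fun z : V * V => z.1 - z.2)%R @^-1` N); split.
- by rewrite -[X in measurable X]setTI; exact: measurable_subrV.
- rewrite /product_measure1; apply: integral0_eq => x _ /=.
  rewrite (_ : xsection _ x = (fun y => x - y)%R @^-1` N).
    by rewrite lebesgue_rV_reflection.
  by rewrite xsectionE.
- by move=> z /= Pz; exact: PN.
Qed.

Lemma le_lebesgue_rV_ae (A B : set V) :
  {ae vol, forall x, A x -> B x} -> vol A <= vol B.
Proof.
move=> [N [mN N0 ABN]]; apply: (@le_trans _ _ (vol (B `|` N))).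
  apply: le_mu_ext => x Ax; have [Bx|Bx] := pselect (B x); [by left|right].
  by apply: ABN => /= /(_ Ax).
by apply: le_trans; [exact: outer_measureU2|rewrite [X in _ + X](_ : _ = 0) ?adde0].
Qed.

Lemma rearrangement_ae f g r : {ae vol, forall x, f x = g x} ->
  rearrangement f r = rearrangement g r.
Proof.
move=> fg; rewrite /rearrangement; congr ereal_inf; congr (image _ _).
apply/seteqP; split => s /= [s0 h]; split => //; apply: le_trans h; apply: le_lebesgue_rV_ae;
  by apply: filterS fg => x fgx /=; rewrite fgx.
Qed.

Lemma sharp_ae f g t : measurable_fun [set: V] g -> {ae vol, forall x, f x = g x} ->
  sharp f t = sharp g t.
Proof.
move=> mg fg; rewrite /sharp (rearrangement_ae _ fg); set c := rearrangement g _.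
rewrite integral_mkcond [RHS]integral_mkcond; apply: ae_eq_integral_nonmeasurable.
  apply/(measurable_restrictT _ _).1; last exact: measurable_funTS.
  by rewrite -[X in measurable X]setTI; exact: emeasurable_fun_infty_o.
apply: filterS fg => x fgx; rewrite !patchE fgx.
suff -> : (x \in [set h | f h < c]) = (x \in [set h | g h < c]) by [].
by apply/idP/idP => /set_mem/= h; apply/mem_set; rewrite /= ?fgx// -fgx.
Qed.

Lemma convolution_ae f g : measurable_fun [set: V] g -> {ae vol, forall x, f x = g x} ->
  convolution f f = convolution g g.
Proof.
move=> mg fg; apply/funext => x; apply: ae_eq_integral_nonmeasurable.
  exact: measurableT_comp (measurable_convolution_integrand mg mg) (@measurable_pair1 _ _ _ _ x).
by apply: filterS2 (ae_reflection x fg) fg => y -> ->.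
Qed.

Lemma qker_ae (nu nu' : V -> R) m : (forall m, measurable_fun [set: V] (qker nu' m)) ->
  {ae vol, forall x, nu x = nu' x} -> {ae vol, forall x, qker nu m x = qker nu' m x}.
Proof.
move=> mq nunu'; elim: m => [|m IH].
  by apply: filterS nunu' => x; rewrite /qker/= => ->.
by rewrite !qkerS (convolution_ae (mq m) IH); exact: aeW.
Qed.

(** A Borel representative of nu need not be even; taking the larger of its values
    at x and -x restores this without changing it almost everywhere. *)
Lemma lebesgue_measurable_even (nu : V -> R) :
  lebesgue_measurable nu -> {ae vol, forall x, (0 <= nu x)%R} ->
  (forall x, nu (- x)%R = nu x) ->
  exists nu' : V -> R, [/\ measurable_fun [set: V] nu', (forall x, (0 <= nu' x)%R),
    (forall x, nu' (- x)%R = nu' x) & {ae vol, forall x, nu x = nu' x}].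
Proof.
move=> [g mg nug] nu0 nuN; have mgN : measurable_fun [set: V] (fun x => g (0 - x)%R).
  exact: measurableT_comp mg (measurable_reflection 0%R).
exists (fun x => Num.max 0 (Num.max (g x) (g (0 - x))))%R; split.
- by apply: measurable_maxr => //; exact: measurable_maxr.
- by move=> x; rewrite le_max lexx.
- by move=> x; rewrite !sub0r opprK [X in Num.max _ X]maxC.
- have nug' := ae_reflection 0%R nug.
  apply: filterS3 nug nug' nu0 => x <- <-; rewrite sub0r nuN maxxx => nux.
  by rewrite max_r.
Qed.

Lemma in_Lp_supported_borel (p : R) (A : set V) (u : V -> R) : measurable A ->
  in_Lp_supported p A u ->
  exists u' : V -> R, [/\ measurable_fun [set: V] u', (forall x, ~ A x -> u' x = 0%R) &
    {ae vol, forall x, u x = u' x}].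
Proof.
move=> mA [[[g mg ug] _] uA]; exists (g \_ A); split.
- by apply/(measurable_restrictT _ _).1 => //; exact: measurable_funTS.
- by move=> x Ax; rewrite patchE ifF//; apply/negP => /set_mem.
- apply: filterS2 ug uA => x ugx uAx; rewrite patchE; case: ifPn => // /negP Ax.
  by apply: uAx => Ax'; apply/Ax/mem_set.
Qed.

(** At almost every pair of points off A the increment of u is zero, so the
    integral may be extended to all pairs. *)
Lemma energyE (p : R) (nu nu' : V -> R) (A : set V) (u u' : V -> R) : (1 <= p)%R ->
  measurable_fun [set: V] nu' -> (forall x, (0 <= nu' x)%R) ->
  measurable_fun [set: V] u' -> (forall x, ~ A x -> u' x = 0%R) ->
  {ae vol, forall x, nu x = nu' x} -> {ae vol, forall x, u x = u' x} ->
  energy p nu A u = kernel_energy p (EFin \o nu') u'.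
Proof.
move=> p1 mnu nu0 mu uA nunu' uu'.
have mnuE : measurable_fun [set: V] (EFin \o nu') by exact/measurable_EFinP.
rewrite -kernel_energyE//.
pose G (z : V * V) := (`|u' z.1 - u' z.2| `^ p)%:E * (EFin \o nu') (z.1 - z.2)%R.
have mG : measurable_fun [set: V * V] G.
  exact: measurable_energy_integrand.
have G0 z : 0 <= G z by rewrite mule_ge0 ?lee_fin ?powR_ge0// nu0.
rewrite /energy integral_mkcond.
transitivity (\int[vol \x vol]_z G z); last first.
  by rewrite (@fubini_tonelli1 _ _ V V R vol vol G mG G0).
apply: ae_eq_integral_nonmeasurable => //.
apply: filterS3 (ae_prod_fst uu') (ae_prod_snd uu') (ae_prod_sub nunu') => z u1 u2 nuz.
rewrite patchE; case: ifPn => [_|/negP zA]; first by rewrite u1 u2 nuz EFinM.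
have [z1 z2] : ~ A z.1 /\ ~ A z.2.
  by split => Az; apply: zA; apply/mem_set => -[].
rewrite /G uA// uA// subrr normr0 powR0 ?mul0e//.
by rewrite gt_eqF// (lt_le_trans _ p1).
Qed.

End almost_everywhere_rV.

(** * The Poincare inequality *)

Lemma near_lt_support_qker (R : realType) n (nu : 'rV[R]_n.+1 -> R) (t : R) :
  (forall m, kernel (qker nu m)) ->
  \forall m \near \oo, t%:E < lebesgue_rV [set x | 0 < qker nu m x].
Proof.
move=> kq; pose v m := lebesgue_rV [set x | 0 < qker nu m x].
have v0 : 0 < v 0%N by exact: kernel_support_gt0.
have vm m : ((3 / 2) ^+ m)%:E * v 0%N <= v m.
  elim: m => [|m IH]; first by rewrite expr0 mul1e.
  rewrite exprS EFinM -muleA; apply: le_trans (support_convolution_growth (kq m)).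
  by rewrite lee_wpmul2l// lee_fin.
(* The volumes grow geometrically; Bernoulli's inequality suffices. *)
have bernoulli m : (1 + m%:R / 2 <= (3 / 2) ^+ m :> R)%R.
  elim: m => [|m IH]; first by rewrite mul0r addr0 expr0.
  have : (0 <= m%:R :> R)%R by [].
  rewrite exprS -natr1; nra.
have [w w0 wv] : exists2 w : R, (0 < w)%R & w%:E <= v 0%N.
  case: (v 0%N) v0 => [r r0||//]; first by exists r.
  by exists 1%R; rewrite ?leey.
have := @nbhs_infty_gtr R (2 * t / w); apply: filterS => m tm.
apply: lt_le_trans (vm m); apply: (@lt_le_trans _ _ (((3 / 2) ^+ m)%:E * w%:E)); last first.
  by rewrite lee_wpmul2l// lee_fin exprn_ge0.
rewrite -EFinM lte_fin; apply: lt_le_trans (ler_wpM2r (ltW w0) (bernoulli m)).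
rewrite ltr_pdivrMr// in tm; nra.
Qed.

Lemma poweR_Lnorm_supported (R : realType) d (p : R) (A : set 'rV[R]_d)
    (u u' : 'rV[R]_d -> R) : (1 <= p)%R ->
  measurable_fun [set: 'rV[R]_d] u' -> (forall x, ~ A x -> u' x = 0%R) ->
  {ae (@lebesgue_rV R d), forall x, u x = u' x} ->
  'N[@lebesgue_rV R d]_(p%:E)[(EFin \o u) \_ A] `^ p =
  \int[@lebesgue_rV R d]_x (`|u' x| `^ p)%:E.
Proof.
move=> p1 mu uA uu'; have p0 : p != 0%R by rewrite gt_eqF// (lt_le_trans _ p1).
rewrite poweR_Lnorm//; apply: ae_eq_integral_nonmeasurable.
  apply/measurable_EFinP; apply: (measurableT_comp (measurable_powR _)).
  exact: measurableT_comp.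
apply: filterS uu' => x ux; rewrite patchE; case: ifPn => [_|/negP xA].
  by rewrite /= ux.
rewrite uA ?normr0 ?abse0 ?poweR0r ?powR0// => Ax; exact/xA/mem_set.
Qed.

Section borel_kernel.
Context (R : realType) (n : nat) (p : R) (nu : 'rV[R]_n.+1 -> R).
Local Notation V := 'rV[R]_n.+1.
Local Notation vol := (@lebesgue_rV R n.+1).
Hypotheses (p1 : (1 <= p)%R).
Hypotheses (mnu : measurable_fun [set: V] nu) (nu0 : forall x, (0 <= nu x)%R).
Hypothesis nuN : forall x, nu (- x)%R = nu x.
Hypothesis nu_int : \int[vol]_(h in ~` eball 1) (nu h)%:E < +oo.
Hypothesis nu_gt0 : 0 < vol [set x | (0 < nu x)%R].
Variables (A : set V) (t : R).
Hypotheses (t0 : (0 <= t)%R) (mA : measurable A) (At : vol A = t%:E).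

Let kq m : kernel (qker nu m).
Proof. exact: kernel_qker. Qed.

Let numerator m : \bar R := (2 `^ (p * m%:R))%:E * 'N[vol]_1[qker nu 0] ^+ (2 ^ m - 1)%N.

Let norm1E : 'N[vol]_1[qker nu 0] = \int[vol]_x qker nu 0 x.
Proof.
rewrite Lnorm1; apply: eq_integral => x _; rewrite gee0_abs//; exact: kernel_ge0 (kq 0) _.
Qed.

Let numerator_gt0 m : 0 < numerator m.
Proof.
rewrite /numerator norm1E mule_gt0 ?lte_fin ?powR_gt0// expe_gt0//.
exact: kernel_gt0 (kq 0).
Qed.

Let numerator_lty m : numerator m < +oo.
Proof.
have Igt := kernel_gt0 (kq 0); have Ilt := kernel_lty (kq 0).
have If : \int[vol]_x qker nu 0 x \is a fin_num by rewrite ge0_fin_numE// ltW.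
by rewrite /numerator norm1E -(fineK If) -EFin_expe -EFinM ltry.
Qed.

Let sharp_ge0 m : 0 <= sharp (qker nu m) t.
Proof. by apply: integral_ge0 => x _; exact: kernel_ge0 (kq m) _. Qed.

Let sharp_lty m : sharp (qker nu m) t < +oo.
Proof.
apply: le_lt_trans (kernel_lty (kq m)); apply: sharp_le_integral.
  exact: kernel_measurable (kq m).
exact: kernel_ge0 (kq m).
Qed.

Let near_sharp_gt0 : \forall m \near \oo, 0 < sharp (qker nu m) t.
Proof.
have [N _ hN] := near_lt_support_qker t kq.
exists N.+1 => // -[//|m] /= Nm.
by apply: sharp_convolution_gt0 => //; exact: (hN m.+1 (ltnW Nm)).
Qed.

Let CsharpE m : 0 < sharp (qker nu m) t ->
  Csharp p nu t m = numerator m * (fine (sharp (qker nu m) t))^-1%:E.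
Proof.
move=> s0; have sf : sharp (qker nu m) t \is a fin_num by rewrite ge0_fin_numE.
rewrite /Csharp/= gt_eqF// -{1}(fineK sf) inver ifF//.
by apply/negbTE; rewrite gt_eqF// fine_gt0// s0 sharp_lty.
Qed.

Lemma near_Csharp_finite : \forall m \near \oo, 0 < Csharp p nu t m < +oo.
Proof.
apply: filterS near_sharp_gt0 => m s0; rewrite CsharpE//.
have f0 : (0 < fine (sharp (qker nu m) t))%R by rewrite fine_gt0// s0 sharp_lty.
rewrite mule_gt0 ?lte_fin ?invr_gt0//= lte_mul_pinfty ?ltry ?ge0_fin_numE ?ltW//.
Qed.

(** When the sharp value vanishes the constant is +oo and only zero energy is at
    issue: the inequality for a larger index, where the constant is finite,
    then shows that u vanishes. *)
Lemma sharp_poincare (u : V -> R) m :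
  measurable_fun [set: V] u -> (forall x, ~ A x -> u x = 0%R) ->
  \int[vol]_x (`|u x| `^ p)%:E <= Csharp p nu t m * kernel_energy p (EFin \o nu) u.
Proof.
move=> mu uA; set L := \int[vol]_x _; set E := kernel_energy p _ u.
have L0 : 0 <= L by apply: integral_ge0 => x _; rewrite lee_fin powR_ge0.
have E0 : 0 <= E by apply: kernel_energy_ge0 => x; rewrite lee_fin.
have bound k : L * sharp (qker nu k) t <= numerator k * E.
  have := sharp_le_kernel_energy p (ltn0Sn n) t0 (kq k) mA At mu uA.
  move=> /le_trans; apply.
  by rewrite /numerator norm1E; exact: kernel_energy_qker.
have finite k : 0 < sharp (qker nu k) t -> L <= Csharp p nu t k * E.
  move=> s0; have sf : sharp (qker nu k) t \is a fin_num by rewrite ge0_fin_numE.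
  rewrite CsharpE// muleAC lee_pdivlMr ?fine_gt0 ?s0 ?sharp_lty//.
  by rewrite fineK.
have [s0|] := boolP (0 < sharp (qker nu m) t); first exact: finite.
rewrite lt0e sharp_ge0 andbT negbK /Csharp/= => /eqP ->; rewrite eqxx.
have [E_eq0|E_neq0] := eqVneq E 0; last first.
  by rewrite gt0_mulye ?leey// lt0e E_neq0.
have [N _ hN] := near_sharp_gt0.
by rewrite (le_trans (finite N (hN N (leqnn N))))// E_eq0 !mule0.
Qed.

End borel_kernel.

Theorem theorem7p4 (R : realType) (d : nat) (hd : (0 < d)%N)
    (p : R) (hp : (1 <= p)%R)
    (nu : 'rV[R]_d -> R)
    (nu_meas : lebesgue_measurable nu)
    (nu_ge0 : forall h : 'rV[R]_d, h != 0%R -> (0 <= nu h)%R)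
    (nu_sym : forall h : 'rV[R]_d, nu (- h)%R = nu h)
    (nu_int : forall r : R, (0 < r)%R ->
      \int[@lebesgue_rV R d]_(h in ~` eball r) `|nu h|%:E < +oo)
    (nu_neq0 : 0 < @lebesgue_rV R d [set h | (0 < nu h)%R])
    (Omega : set 'rV[R]_d) (Omega_open : open Omega)
    (Omega_fin : @lebesgue_rV R d Omega < +oo) :
  (forall (m : nat) (u : 'rV[R]_d -> R), in_Lp_supported p Omega u ->
    'N[@lebesgue_rV R d]_(p%:E)[(EFin \o u) \_ Omega] `^ p <=
      Csharp p nu (fine (lebesgue_rV Omega)) m * energy p nu Omega u) /\
  (\forall m \near \oo, 0 < Csharp p nu (fine (lebesgue_rV Omega)) m < +oo).
Proof.
case: d hd nu nu_meas nu_ge0 nu_sym nu_int nu_neq0 Omega Omega_open Omega_fin => // n _ {}nu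
  {}nu_meas {}nu_ge0 {}nu_sym {}nu_int {}nu_neq0 {}Omega {}Omega_open {}Omega_fin.
pose vol : {measure set 'rV[R]_n.+1 -> \bar R} := @lebesgue_rV R n.+1.
have mO := open_measurable_rV Omega_open.
have nu_ae : {ae vol, forall x, (0 <= nu x)%R}.
  exists [set x : 'rV[R]_n.+1 | x ord0 ord0 = 0%R]; split.
  - rewrite -[X in measurable X]setTI.
    exact: (@measurable_coord R n.+1 ord0 measurableT [set 0%R]).
  - exact: lebesgue_rV_hyperplane.
  - move=> x /=; apply: contra_notP => x0; apply: nu_ge0; apply/eqP => xE; apply: x0.
    by rewrite xE mxE.
have [nu' [mnu nu0 nuN nunu']] := lebesgue_measurable_even nu_meas nu_ae nu_sym.
have nu'_int : \int[vol]_(h in ~` eball 1) (nu' h)%:E < +oo.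
  apply: le_lt_trans (nu_int 1%R ltr01); rewrite le_eqVlt; apply/orP; left; apply/eqP.
  rewrite integral_mkcond [RHS]integral_mkcond; apply/esym.
  apply: ae_eq_integral_nonmeasurable.
    apply/(measurable_restrictT _ _).1; first exact: measurableC (@measurable_eball R n.+1 1%R).
    by apply: measurable_funTS; exact/measurable_EFinP.
  by apply: filterS nunu' => x nux; rewrite !patchE; case: ifP => // _ /=; rewrite nux ger0_norm.
have nu'_gt0 : 0 < vol [set x | (0 < nu' x)%R].
  apply: lt_le_trans nu_neq0 _; apply: le_lebesgue_rV_ae.
  by apply: filterS nunu' => x /= ->.
pose t := fine (vol Omega).
have Ot : vol Omega = t%:E by rewrite /t fineK// ge0_fin_numE.
have t0 : (0 <= t)%R by exact: fine_ge0.
have mq m : measurable_fun setT (qker nu' m) by exact: kernel_measurable (kernel_qker _ _ _ _ _ _).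
have CE m : Csharp p nu t m = Csharp p nu' t m.
  rewrite /Csharp (sharp_ae _ (mq m) (qker_ae m mq nunu')) !Lnorm1.
  congr (if _ then _ else _ * _ ^+ _ / _).
  apply: ae_eq_integral_nonmeasurable; first exact: measurableT_comp.
  by apply: filterS (qker_ae 0 mq nunu') => x ->.
split; last first.
  apply: filterS (near_Csharp_finite p mnu nu0 nuN nu'_int nu'_gt0 t0) => m.
  by rewrite CE.
move=> m u uOmega.
have [u' [mu uO uu']] := in_Lp_supported_borel mO uOmega.
rewrite (poweR_Lnorm_supported hp mu uO uu') (energyE hp mnu nu0 mu uO nunu' uu') CE.
exact: (sharp_poincare hp mnu nu0 nuN nu'_int nu'_gt0 t0 mO Ot).
Qed.
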